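(* There exist non-trivial (that is, $\vec u\neq 0$) solutions $\vec u$ to the steady Navier--Stokes equations on $\mathbb{T}^2=\mathbb{R}^2/2\pi\mathbb{Z}^2$ $$\Delta\vec u-\mathbb{P}(\vec u\cdot\vec\nabla\vec u)=0,\qquad \mathrm{div}\,\vec u=0,$$ where $\vec u$ is an admissible vector field with mean value $0$ and $\vec u\in H^{-1}(\mathbb{T}^2)\cap BMO^{-1}$. Here $\mathbb{P}(\vec u\cdot\vec\nabla\vec u)$ is defined, for the admissible vector field $\vec u$, as the sum of the double series given in the context.
   Context: Vector fields are real, with two components, and periodic: $\mathbb{T}^2=\mathbb{R}^2/2\pi\mathbb{Z}^2$. Equations hold in the sense of periodic distributions. Notation: for $k=(k_1,k_2)$, $k^\perp=(-k_2,k_1)$ and $|k|^2=k_1^2+k_2^2$. The set $\mathbb{Z}^2_+$ consists of those $k=(k_1,k_2)\in\mathbb{Z}^2\setminus\{(0,0)\}$ with $\arg(k_1+\mathrm{i}k_2)\in(-\pi/2,\pi/2]$ (so exactly one of $k,-k$ belongs to $\mathbb{Z}^2_+$ for each $k\ne(0,0)$). A periodic distribution vector field with mean value $0$ is a series $\sum_{k\in\mathbb{Z}^2_+}\cos(k\cdot x)\vec v_k+\sin(k\cdot x)\vec w_k$, with $\vec v_k,\vec w_k\in\mathbb{R}^2$ satisfying $|\vec v_k|+|\vec w_k|\le C|k|^N$ for some constants $C,N$. Leray projection: $$\mathbb{P}\Big(\sum_{k\in\mathbb{Z}^2_+}\cos(k\cdot x)\vec v_k+\sin(k\cdot x)\vec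 w_k\Big)=\sum_{k\in\mathbb{Z}^2_+}\Big(\cos(k\cdot x)\frac{\vec v_k\cdot k^\perp}{|k|^2}+\sin(k\cdot x)\frac{\vec w_k\cdot k^\perp}{|k|^2}\Big)k^\perp .$$ Admissible vector fields: a divergence free periodic distribution vector field $\vec u$ is admissible (for the steady problem on $\mathbb{T}^2$) if it is of the form $$\vec u=\sum_{k\in\mathbb{Z}^2_+}\vec u_k,\qquad \vec u_k=\rho_k\cos(k\cdot x+\theta_k)\,k^\perp,\quad \rho_k\ge 0,\ \theta_k\in\mathbb{R},$$ with, for some $N$, $$\sum_{k_1\in\mathbb{Z}^2_+}\sum_{k_2\in\mathbb{Z}^2_+}\rho_{k_1}\rho_{k_2}\,\big\|\mathbb{P}\big(\cos(k_1\cdot x+\theta_{k_1})\sin(k_2\cdot x+\theta_{k_2})\,(k_1^\perp\cdot k_2)\,k_2^\perp\big)\big\|_{H^{-N}(\mathbb{T}^2)}<+\infty .$$ (In these sums $k_1,k_2$ denote elements of $\mathbb{Z}^2_+$.) For an admissible vector field one defines $$\mathbb{P}(\vec u\cdot\vec\nabla\vec u)=\sum_{k_1\in\mathbb{Z}^2_+}\sum_{k_2\in\mathbb{Z}^2_+}\mathbb{P}(\vec u_{k_1}\cdot\vec\nabla\vec u_{k_2}),$$ the series being absolutely convergent in $H^{-N}(\mathbb{T}^2)$. $H^s(\mathbb{T}^2)$ is the usual Sobolev space. $BMO^{-1}$ is the usual (Koch--Tataru) space of distributions that can be written as $\partial_1f_1+\partial_2f_2$ with $f_1,f_2\in BMO$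 (componentwise for vector fields). *)

(* Defs.v *)
From HB Require Import structures.
From mathcomp Require Import all_boot all_order all_algebra finmap.
From mathcomp Require Import all_classical all_reals all_analysis.

Set Implicit Arguments.
Unset Strict Implicit.
Unset Printing Implicit Defensive.

Import Order.TTheory GRing.Theory Num.Theory.
Import numFieldNormedType.Exports.

Local Open Scope classical_set_scope.
Local Open Scope ring_scope.

(* For a nonzero k, the argument of k.1 + i k.2 lies in ]-pi/2, pi/2] exactly
   when k.1 > 0, or k.1 = 0 and k.2 > 0. *)
Definition half_lattice (k : int * int) : bool :=
  (0 < k.1) || ((k.1 == 0) && (0 < k.2)).

Notation Z2plus := {k : int * int | half_lattice k}.

(* u : tseries V stands for the formal series without constant term
     \sum_(k in Z2plus) cos(k.x) (u k).1 + sin(k.x) (u k).2.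
   Polynomial growth of the coefficients, which makes it a distribution, is the
   separate predicate periodic_distribution. *)
Notation tseries V := (Z2plus -> (V * V)%type).

Section Defs.
Context {R : realType}.

Notation plane := (measurableTypeR R * measurableTypeR R)%type.
Notation vec := (R * R)%type.
Notation area := (@lebesgue_measure R \x @lebesgue_measure R)%E.

Definition dot (a b : vec) : R := a.1 * b.1 + a.2 * b.2.
Definition perp (a : vec) : vec := (- a.2, a.1).
Definition scale (c : R) (a : vec) : vec := (c * a.1, c * a.2).
Definition normE (a : vec) : R := Num.sqrt (dot a a).

Definition freq (k : Z2plus) : vec := ((val k).1%:~R, (val k).2%:~R).

Definition comp1 (u : tseries vec) : tseries R := fun k => ((u k).1.1, (u k).2.1).
Definition comp2 (u : tseries vec) : tseries R := fun k => ((u k).1.2, (u k).2.2).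
Definition pair_series (f g : tseries R) : tseries vec :=
  fun k => (((f k).1, (g k).1), ((f k).2, (g k).2)).

Definition periodic_distribution (u : tseries vec) : Prop :=
  exists (C : R) (N : nat), forall k : Z2plus,
    normE (u k).1 + normE (u k).2 <= C * normE (freq k) ^+ N.

(* d_j (a cos(k.x) + b sin(k.x)) = k_j b cos(k.x) - k_j a sin(k.x). *)
Definition d1 (f : tseries R) : tseries R :=
  fun k => ((freq k).1 * (f k).2, - ((freq k).1 * (f k).1)).
Definition d2 (f : tseries R) : tseries R :=
  fun k => ((freq k).2 * (f k).2, - ((freq k).2 * (f k).1)).

Definition laplacian0 (f : tseries R) : tseries R := d1 (d1 f) + d2 (d2 f).
Definition laplacian (u : tseries vec) : tseries vec :=
  pair_series (laplacian0 (comp1 u)) (laplacian0 (comp2 u)).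
Definition divergence (u : tseries vec) : tseries R :=
  d1 (comp1 u) + d2 (comp2 u).

Definition leray (u : tseries vec) : tseries vec := fun k =>
  let kp := perp (freq k) in
  (scale (dot (u k).1 kp / normE (freq k) ^+ 2) kp,
   scale (dot (u k).2 kp / normE (freq k) ^+ 2) kp).

(* The squared norm is \sum_(k in Z^2) (1 + |k|^2)^s |c_k|^2 where c_k are the
   complex Fourier coefficients: c_k = (a - i b) / 2 and c_(-k) = conj c_k for
   (a, b) = u k, so that the frequencies k and -k contribute together
   (1 + |k|^2)^s (|a|^2 + |b|^2) / 2. *)
Definition sobolev_norm (s : R) (u : tseries vec) : \bar R :=
  sqrte (\esum_(k in [set: Z2plus])
    ((1 + normE (freq k) ^+ 2) `^ s
       * ((normE (u k).1 ^+ 2 + normE (u k).2 ^+ 2) / 2))%:E).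

Definition sobolev (s : R) (u : tseries vec) : Prop :=
  (sobolev_norm s u < +oo)%E.

Definition square (a b r : R) : set plane :=
  `[a, a + r]%classic `*` `[b, b + r]%classic.

Definition torus_cell : set plane := square 0 0 (2 * pi).

(* The constant coefficient of f is dropped. *)
Definition fourier (f : plane -> R) : tseries R := fun k =>
  ((2 * pi ^+ 2)^-1 *
     (\int[area]_(x in torus_cell) (f x * cos (dot (freq k) x)))%R,
   (2 * pi ^+ 2)^-1 *
     (\int[area]_(x in torus_cell) (f x * sin (dot (freq k) x)))%R).

(* For the products of two modes occurring below, no information is lost by
   dropping the constant coefficient: they have mean value 0. *)
Definition fourier_vec (F : plane -> vec) : tseries vec :=
  pair_series (fourier (fun x => (F x).1)) (fourier (fun x => (F x).2)).

Definition mode (u : tseries vec) (k : Z2plus) : plane -> vec := fun x =>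
  scale (cos (dot (freq k) x)) (u k).1 + scale (sin (dot (freq k) x)) (u k).2.

Definition partial1 (g : plane -> R) (x : plane) : R :=
  derive1 (fun t : R => g (t, x.2)) x.1.
Definition partial2 (g : plane -> R) (x : plane) : R :=
  derive1 (fun t : R => g (x.1, t)) x.2.

Definition advect (a b : plane -> vec) : plane -> vec := fun x =>
  ((a x).1 * partial1 (fun y => (b y).1) x
     + (a x).2 * partial2 (fun y => (b y).1) x,
   (a x).1 * partial1 (fun y => (b y).2) x
     + (a x).2 * partial2 (fun y => (b y).2) x).

Definition admissible (u : tseries vec) : Prop :=
  [/\ periodic_distribution u, divergence u = 0 &
    exists (rho theta : Z2plus -> R),
      [/\ forall k, 0 <= rho k,
          forall k x, mode u k x =
            scale (rho k * cos (dot (freq k) x + theta k)) (perp (freq k)) &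
          exists N : nat,
            (\esum_(k1 in [set: Z2plus]) \esum_(k2 in [set: Z2plus])
               ((rho k1 * rho k2)%:E * sobolev_norm (- N%:R)%R (leray
                 (fourier_vec (fun x =>
                    scale (cos (dot (freq k1) x + theta k1)
                             * sin (dot (freq k2) x + theta k2)
                             * dot (perp (freq k1)) (freq k2))
                      (perp (freq k2))))))
             < +oo)%E]].

Definition interaction (u : tseries vec) (k1 k2 : Z2plus) : tseries vec :=
  leray (fourier_vec (advect (mode u k1) (mode u k2))).

(* T is the sum P(u . grad u) of the double series of interactions, absolutely
   convergent in some H^(-N); the partial sums are taken along the finite
   subsets of Z2plus * Z2plus directed by inclusion. *)
Definition convection_sum (u T : tseries vec) : Prop :=
  exists N : nat,
    (\esum_(k1 in [set: Z2plus]) \esum_(k2 in [set: Z2plus])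
       sobolev_norm (- N%:R)%R (interaction u k1 k2) < +oo)%E /\
    forall e : R, 0 < e ->
      exists A0 : {fset (Z2plus * Z2plus)%type},
        forall A : {fset (Z2plus * Z2plus)%type}, (A0 `<=` A)%fset ->
          (sobolev_norm (- N%:R)%R
             (T - \sum_(p <- A) interaction u p.1 p.2)%R < e%:E)%E.

Definition steady_navier_stokes (u : tseries vec) : Prop :=
  (exists2 T : tseries vec, convection_sum u T & laplacian u - T = 0)
  /\ divergence u = 0.

Definition torus_periodic (f : plane -> R) : Prop :=
  forall x : plane, f (x.1 + 2 * pi, x.2) = f x /\ f (x.1, x.2 + 2 * pi) = f x.

Definition mean (a b r : R) (f : plane -> R) : R :=
  (r ^+ 2)^-1 * (\int[area]_(x in square a b r) f x)%R.

(* BMO of the torus: periodic locally integrable functions of bounded mean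
   oscillation over all squares of the plane. *)
Definition bmo (f : plane -> R) : Prop :=
  [/\ torus_periodic f,
      forall a b r : R, 0 < r -> area.-integrable (square a b r) (EFin \o f) &
      exists M : R, forall a b r : R, 0 < r ->
        mean a b r (fun x => `|f x - mean a b r f|) <= M].

Definition bmo_inv (g : tseries R) : Prop :=
  exists f1 f2 : plane -> R,
    [/\ bmo f1, bmo f2 & g = d1 (fourier f1) + d2 (fourier f2)].

Definition bmo_inv_vec (u : tseries vec) : Prop :=
  bmo_inv (comp1 u) /\ bmo_inv (comp2 u).

End Defs.

(* Main.v *)
From HB Require Import structures.
Require Import Defs.
From mathcomp Require Import all_boot all_order all_algebra finmap.
From mathcomp Require Import all_classical all_reals all_analysis.
From mathcomp Require Import measurable_realfun ring lra zify.

(* Look for u = \sum_k a_k sin(k.x) k^perp with real a_k.  Two modes p, q interact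
   only at the frequencies p + q and p - q, and the equation at frequency m reads
     a_m + \sum_(k1, k2) a_k1 a_k2 coupling k1 k2 m = 0.
   Enumerate the frequencies as m_0, m_1, ... and solve these equations one after
   the other: at step t the modes n and n + m_t are added, with n huge, with
   amplitude 1/L at n (L of the order of |n|) and with the amplitude at n + m_t
   chosen so that their difference interaction cancels what the earlier modes
   leave at m_t.  When n grows fast enough with t, every other new interaction has
   a frequency far beyond m_0, ..., m_t, so the equations already solved are never
   disturbed.  The amplitudes a_k are absolutely summable: the stream function is
   bounded, which gives BMO^-1, and u is in H^-1.  The double series converges
   absolutely in H^-4, because apart from the pairs (n, n + m_t) both interacting
   frequencies are bounded by a multiple of the resulting one, and because the
   sources left at the m_t are summable. *)

Set Implicit Arguments.
Unset Strict Implicit.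
Unset Printing Implicit Defensive.

Import Order.TTheory GRing.Theory Num.Theory.
Import numFieldNormedType.Exports.

Local Open Scope classical_set_scope.
Local Open Scope ring_scope.

(** * Trigonometric integrals over the torus *)

Section Trigonometric_integrals.
Context {R : realType}.
Notation plane := (measurableTypeR R * measurableTypeR R)%type.
Notation area := (@lebesgue_measure R \x @lebesgue_measure R)%E.
Implicit Types (c r : R) (p : int * int).

Definition zvec p : R * R := (p.1%:~R, p.2%:~R).

Lemma cosD2pi_int c (n : int) : cos (c + n%:~R * (2 * pi)) = cos c.
Proof.
have nat_case (m : nat) (d : R) : cos (d + m%:~R * (2 * pi)) = cos d.
  elim: m d => [|m IH] d; first by rewrite mul0r addr0.
  have -> : d + m.+1%:~R * (2 * pi) = (d + m%:~R * (2 * pi)) + pi *+ 2.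
    by rewrite -[m.+1]addn1 PoszD intrD; ring.
  by rewrite cosD2pi IH.
case: n => m; first exact: nat_case.
by rewrite -(nat_case m.+1) NegzE; congr cos; rewrite mulrNz; ring.
Qed.

Lemma is_derive_affine c r (t : R) : is_derive t 1 (fun s : R => c + r * s) r.
Proof.
rewrite (_ : (fun s => _) = cst c + r \*: (@id R)); last by [].
by apply: is_derive_eq; rewrite add0r [_ *: _]mulr1.
Qed.

Lemma is_derive_sin_affine c r (t : R) :
  is_derive t 1 (fun s : R => sin (c + r * s)) (r * cos (c + r * t)).
Proof.
rewrite mulrC.
exact: (@is_derive1_comp _ (@sin R) (fun s => c + r * s) t _ _
         (is_derive_sin (c + r * t)) (is_derive_affine c r t)).
Qed.

Let period : set R := `[0, 0 + 2 * pi]%classic.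

Lemma integral_cos_int c (n : int) :
  (\int[@lebesgue_measure R]_(t in period)
     (cos (c + n%:~R * t)%R)%:E)%E =
  (if n == 0 then 2 * pi * cos c else 0)%:E.
Proof.
have pi2 : (0 : R) < 0 + 2 * pi by rewrite add0r mulr_gt0 ?pi_gt0.
case: eqVneq => [->|n0].
  under eq_integral do rewrite mul0r addr0.
  rewrite integral_cst; last exact: measurable_itv.
  rewrite [X in (_ * X)%E]lebesgue_measure_itv /= lte_fin pi2 -EFinB -EFinM.
  by congr (_%:E); ring.
have nR0 : n%:~R != 0 :> R by rewrite intr_eq0.
pose F (s : R) := n%:~R^-1 * sin (c + n%:~R * s).
have derF (t : R) : is_derive t 1 F (cos (c + n%:~R * t)).
  have := is_derive_sin_affine c n%:~R t => dsin.
  rewrite (_ : F = n%:~R^-1 \*: (fun s => sin (c + n%:~R * s))); last by [].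
  by apply: is_derive_eq; rewrite [_ *: _]mulrA mulVf// mul1r.
have contF : continuous F.
  by move=> t; apply: differentiable_continuous; apply/derivable1_diffP.
rewrite (@continuous_FTC2 _ _ F)//.
- rewrite -EFinB; congr (_%:E).
  rewrite /F !(add0r, mulr0, addr0) -mulrBr.
  suff -> : sin (c + n%:~R * (2 * pi)) = sin c by rewrite subrr mulr0.
  rewrite -(cosBpihalf c) -(cosD2pi_int (c - pi / 2) n) -cosBpihalf.
  by congr cos; ring.
- apply: continuous_subspaceT => t.
  apply: continuous_comp; last exact: continuous_cos.
  apply: differentiable_continuous; apply/derivable1_diffP.
  by case: (is_derive_affine c n%:~R t).
- split; first by move=> t _; case: (derF t).
  + exact/cvg_at_right_filter/contF.
  + exact/cvg_at_left_filter/contF.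
- by move=> t _; rewrite derive1E; case: (derF t).
Qed.

Lemma measurable_dot p : measurable_fun [set: plane] (fun x : plane => dot (zvec p) x).
Proof. by apply: measurable_funD; apply: measurable_funM. Qed.

Lemma measurable_cos_mode c p :
  measurable_fun [set: plane] (fun x : plane => cos (c + dot (zvec p) x)).
Proof.
apply: (measurableT_comp (continuous_measurable_fun (@continuous_cos R))).
by apply: measurable_funD => //; exact: measurable_dot.
Qed.

Lemma measurable_square (a b r : R) : measurable (square a b r : set plane).
Proof. exact: measurableX. Qed.

Lemma area_square (a b r : R) : 0 < r -> area (square a b r) = (r ^+ 2)%:E.
Proof.
move=> r0; rewrite product_measure1E//= !lebesgue_measure_itv/= !lte_fin !ltrDl r0.
by rewrite -!EFinB -EFinM; congr (_%:E); ring.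
Qed.

Lemma bounded_integrable_square (f : plane -> R) (M a b r : R) : 0 < r ->
  measurable_fun [set: plane] f -> (forall x, `|f x| <= M) ->
  area.-integrable (square a b r) (EFin \o f).
Proof.
move=> r0 mf fM; apply: measurable_bounded_integrable.
- exact: measurable_square.
- by rewrite [ltLHS]area_square// ltry.
- exact: measurable_funTS.
- by exists M; split; [exact: num_real|move=> y My x _; apply: le_trans (fM x) (ltW My)].
Qed.

Lemma integrable_cos_mode c p (a b r : R) : 0 < r ->
  area.-integrable (square a b r) (EFin \o (fun x => cos (c + dot (zvec p) x))).
Proof.
move=> r0; apply: (bounded_integrable_square (M := 1)) => //.
  exact: measurable_cos_mode.
by move=> x; rewrite ler_norml cos_geN1 cos_le1.
Qed.

(** Fubini: the inner integral vanishes unless [p.2] is 0, the outer one unless [p.1] is 0. The free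
    phase [c] covers sines too, as cosines with phase [- (pi / 2)]. *)
Lemma Rintegral_cos_mode c p :
  (\int[area]_(x in torus_cell) cos (c + dot (zvec p) x))%R =
  if p == 0 then 4 * pi ^+ 2 * cos c else 0.
Proof.
have pi2 : (0 : R) < 2 * pi by rewrite mulr_gt0 ?pi_gt0.
have icos := integrable_cos_mode c p 0 0 pi2.
rewrite /Rintegral integral_mkcond -integral12_prod_meas1; last first.
  exact: (iffLR (integrable_mkcond _ (measurable_square _ _ _)) icos).
rewrite /fubini_F.
have inner (s : R) :
   (\int[@lebesgue_measure R]_t (((fun x => (cos (c + dot (zvec p) x)%R)%:E) \_ torus_cell) (s, t))
)%E = ((fun s => ((if p.2 == 0 then 2 * pi else 0) * cos (c + p.1%:~R * s))%:E) \_ period) s.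
  rewrite patchE; case: ifPn => [sP|sP].
    transitivity (\int[@lebesgue_measure R]_(t in period)
        (cos (c + p.1%:~R * s + p.2%:~R * t)%R)%:E)%E.
      rewrite [RHS]integral_mkcond; apply: eq_integral => t _.
      rewrite !patchE /torus_cell /square in_setX sP /=.
      by rewrite /dot/= addrA.
    by rewrite integral_cos_int; case: ifP => //; rewrite mul0r.
  rewrite integral0_eq// => t _; rewrite patchE.
  by rewrite /torus_cell /square in_setX (negbTE sP).
under eq_integral do rewrite inner.
rewrite -integral_mkcond.
case: (eqVneq p.2 0) => p2; last first.
  rewrite integral0_eq; last by move=> s _; rewrite mul0r.
  by rewrite (_ : (p == 0) = false)//; apply: contraNF p2 => /eqP ->.
under eq_integral do rewrite EFinM.
rewrite integralZl; first last.
- apply: continuous_compact_integrable; first exact: segment_compact.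
  apply: continuous_subspaceT => t.
  apply: continuous_comp; last exact: continuous_cos.
  apply: differentiable_continuous; apply/derivable1_diffP.
  by case: (is_derive_affine c p.1%:~R t).
- exact: measurable_itv.
rewrite [X in (_ * X)%E](integral_cos_int c p.1).
case: (eqVneq p.1 0) => p1.
  have -> : p = 0 by move: p1 p2; case: (p) => /= a b -> ->.
  by rewrite eqxx -EFinM /=; ring.
by rewrite mule0 (_ : (p == 0) = false)//; apply: contraNF p1 => /eqP ->.
Qed.

End Trigonometric_integrals.

(** * Fourier coefficients of a product of two modes *)

Section Fourier.
Context {R : realType}.
Notation plane := (measurableTypeR R * measurableTypeR R)%type.
Notation area := (@lebesgue_measure R \x @lebesgue_measure R)%E.
Implicit Types (c r : R) (p q m : int * int).

(** Integration of a trigonometric polynomial: an entry of [s] consists of an amplitude, a phase and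
    a frequency, and only zero frequencies contribute. *)
Lemma Rintegral_cos_modes (f : plane -> R) (s : seq (R * R * (int * int))) :
  (forall x, f x = \sum_(i <- s) i.1.1 * cos (i.1.2 + dot (zvec i.2) x)) ->
  (\int[area]_(x in torus_cell) f x)%R =
  \sum_(i <- s) i.1.1 * (if i.2 == 0 then 4 * pi ^+ 2 * cos i.1.2 else 0).
Proof.
have pi2 : (0 : R) < 2 * pi by rewrite mulr_gt0 ?pi_gt0.
have mcell : measurable (torus_cell : set plane) by exact: measurable_square.
have int1 (i : R * R * (int * int)) : area.-integrable torus_cell
    (EFin \o (fun x => i.1.1 * cos (i.1.2 + dot (zvec i.2) x))).
  exact: (integrableZl mcell i.1.1 (integrable_cos_mode _ _ _ _ pi2)).
move=> fE; under eq_Rintegral do rewrite fE.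
elim: s {fE} => [|i s IH].
  rewrite big_nil; under eq_Rintegral do rewrite big_nil.
  by rewrite Rintegral_cst// mul0r.
rewrite big_cons -IH; under eq_Rintegral do rewrite big_cons.
rewrite RintegralD//; last first.
  rewrite (_ : _ \o _ = (fun x => \sum_(j <- s) (j.1.1 * cos (j.1.2 + dot (zvec j.2) x))%:E)%E).
    by apply: integrable_sum => // j _; exact: int1.
  by apply/funext => x /=; rewrite sumEFin.
congr (_ + _); rewrite RintegralZl//; last exact: integrable_cos_mode.
by rewrite Rintegral_cos_mode.
Qed.

(* \int sin(p.x) sin(m.x) dx = 2 pi^2 odd_delta p m over the torus. *)
Definition odd_delta p m : R := (p == m)%:R - (p == - m)%:R.

Lemma odd_deltaN p m : odd_delta (- p) m = - odd_delta p m.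
Proof. by rewrite /odd_delta eqr_opp eqr_oppLR opprB. Qed.

Lemma dotDl p q (x : plane) : dot (zvec (p + q)) x = dot (zvec p) x + dot (zvec q) x.
Proof. by rewrite /dot/zvec /= !intrD; ring. Qed.

Lemma dotNl p (x : plane) : dot (zvec (- p)) x = - dot (zvec p) x.
Proof. by rewrite /dot/zvec /= !intrN; ring. Qed.

Lemma fourier_sin_cos c p q (k : Z2plus) :
  fourier (fun x => c * (sin (dot (zvec p) x) * cos (dot (zvec q) x))) k =
  (0, c / 2 * (odd_delta (p + q) (val k) + odd_delta (p - q) (val k))).
Proof.
have pi0 : pi != 0 :> R by rewrite gt_eqF// pi_gt0.
set m := val k.
(* [s 0] is the product-to-sum expansion against sin(m.x). [s'] at phase [- (pi / 2)] is the one
   against cos(m.x); all its terms integrate to 0, even at frequency 0, because cos(- pi / 2) =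
   0. *)
pose s (e : R) : seq (R * R * (int * int)) := [:: (c / 4, e, p + q - m); (- c / 4, e, p + q + m);
                (c / 4, e, p - q - m); (- c / 4, e, p - q + m)].
pose s' (e : R) : seq (R * R * (int * int)) := [:: (c / 4, e, p + q - m); (c / 4, e, p + q + m);
                (c / 4, e, p - q - m); (c / 4, e, p - q + m)].
have dm (x : plane) : dot (freq k) x = dot (zvec m) x by [].
rewrite /fourier; congr pair.
  transitivity ((2 * pi ^+ 2)^-1 * \sum_(i <- s' (- (pi / 2)))
      i.1.1 * (if i.2 == 0 then 4 * pi ^+ 2 * cos i.1.2 else 0)).
    congr (_ * _); apply: Rintegral_cos_modes => x.
    rewrite /s' !big_cons big_nil /= !dotDl !dotNl dm ![- _ + _]addrC !cosBpihalf.
    by rewrite !(sinD, cosD, sinN, cosN); field.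
  rewrite /s' !big_cons big_nil /= cosN cos_pihalf.
  by rewrite !mulr0 !if_same; ring.
transitivity ((2 * pi ^+ 2)^-1 * \sum_(i <- s 0)
    i.1.1 * (if i.2 == 0 then 4 * pi ^+ 2 * cos i.1.2 else 0)).
  congr (_ * _); apply: Rintegral_cos_modes => x.
  rewrite /s !big_cons big_nil /= !dotDl !dotNl dm !add0r.
  by rewrite !(sinD, cosD, sinN, cosN); field.
rewrite /s !big_cons big_nil /= cos0 !mulr1 /odd_delta.
rewrite !subr_eq0 !addr_eq0.
set b1 := p + q == m; set b2 := p + q == - m; set b3 := p - q == m; set b4 := p - q == - m.
move: pi0; generalize (@pi R) => P P0.
by case: b1; case: b2; case: b3; case: b4 => /=; field.
Qed.
End Fourier.

(** * Sine flows *)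

Section Sine_flows.
Context {R : realType}.
Notation plane := (measurableTypeR R * measurableTypeR R)%type.
Notation vec := (R * R)%type.
Implicit Types (a b g : Z2plus -> R) (k m : Z2plus).

Definition sq_norm (p : int * int) : R := dot (zvec p) (zvec p).

Lemma sq_normE k : normE (freq k) ^+ 2 = sq_norm (val k) :> R.
Proof. by rewrite sqr_sqrtr// addr_ge0// -expr2 sqr_ge0. Qed.

Lemma half_lattice_neq0 p : half_lattice p -> p != 0.
Proof. by apply: contraTneq => ->. Qed.

Lemma sq_norm_ge1 p : p != 0 -> 1 <= sq_norm p.
Proof.
case: p => x y p0; rewrite /sq_norm /dot /= -!intrM -intrD ler1z.
have : x != 0 \/ y != 0.
  by case: (eqVneq x 0) p0 => [-> |]; [case: (eqVneq y 0) => [->|]; auto|auto].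
by case; nia.
Qed.

Lemma sq_norm_Z2plus k : 1 <= sq_norm (val k).
Proof. exact/sq_norm_ge1/half_lattice_neq0/valP. Qed.

(** Its stream function is - \sum_k b_k cos(k.x). *)
Definition flow b : tseries vec := fun k => ((0, 0), scale (b k) (perp (freq k))).

(* |m|^-2 times the coefficient of sin(m.x) m^perp in the Leray projection of
   (sin(p.x) p^perp . grad) (sin(q.x) q^perp).  It is even in p and in q, so that the
   choice of a representative in Z2plus does not matter. *)
Definition coupling (p q m : int * int) : R :=
  dot (perp (zvec p)) (zvec q) * dot (zvec q) (zvec m) *
    (odd_delta (p + q) m + odd_delta (p - q) m) / (2 * sq_norm m ^+ 2).

(** A product of a sine and a cosine has sine coefficients only, and the projection makes each a
    multiple of m^perp: sine flows are closed under the nonlinearity. *)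
Lemma leray_fourier_sin_cos (c : R) k1 k2 :
  leray (fourier_vec (fun x : plane =>
    scale (c * (sin (dot (freq k1) x) * cos (dot (freq k2) x))) (perp (freq k2)))) =
  flow (fun m => c * dot (freq k2) (freq m) / (2 * sq_norm (val m)) *
    (odd_delta (val k1 + val k2) (val m) + odd_delta (val k1 - val k2) (val m))).
Proof.
apply/funext => m.
have fE (d : R) : fourier (fun x : plane =>
    c * (sin (dot (freq k1) x) * cos (dot (freq k2) x)) * d) m =
  (0, c * d / 2 * (odd_delta (val k1 + val k2) (val m)
                 + odd_delta (val k1 - val k2) (val m))).
  rewrite -fourier_sin_cos; congr (fourier _ m); apply/funext => x.
  by rewrite mulrAC.
pose f (d : R) (x : plane) := c * (sin (dot (freq k1) x) * cos (dot (freq k2) x)) * d.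
pose d1 := (perp (freq k2)).1 : R; pose d2 := (perp (freq k2)).2 : R.
rewrite /leray (_ : fourier_vec _ m = (((fourier (f d1) m).1, (fourier (f d2) m).1),
  ((fourier (f d1) m).2, (fourier (f d2) m).2))); last by [].
rewrite !fE sq_normE /flow; congr pair.
  by rewrite /dot /scale /= !mul0r addr0 !mul0r.
congr (scale _ _); rewrite /d1 /d2 /dot /perp /=.
by have := sq_norm_Z2plus m; set n := sq_norm _ => n1; field; lra.
Qed.

Lemma mode_flow a k x : mode (flow a) k x = scale (a k * sin (dot (freq k) x)) (perp (freq k)).
Proof.
by rewrite /mode /flow /scale [LHS]/GRing.add /=; congr pair => /=; ring.
Qed.

(** The derivative turns the second sine into a cosine, so that [leray_fourier_sin_cos] applies. The
    factor [sq_norm] also occurs in [laplacian_flow]; dividing by it leaves one scalar equation per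
    frequency. *)
Lemma interaction_flow a k1 k2 :
  interaction (flow a) k1 k2 =
  flow (fun m => a k1 * a k2 * coupling (val k1) (val k2) (val m) * sq_norm (val m)).
Proof.
pose c : R := a k1 * a k2 * dot (perp (freq k1)) (freq k2).
transitivity (leray (fourier_vec (fun x : plane =>
    scale (c * (sin (dot (freq k1) x) * cos (dot (freq k2) x))) (perp (freq k2))))).
  congr (leray (fourier_vec _)); apply/funext => x.
  have part1 (d : R) :
      partial1 (fun y : plane => a k2 * sin (dot (freq k2) y) * d) x =
      a k2 * (freq k2).1 * cos (dot (freq k2) x) * d.
    rewrite /partial1 derive1E.
    have := is_derive_sin_affine ((freq k2).2 * x.2) (freq k2).1 x.1 => dsin.
    rewrite (_ : (fun _ => _) =
        (a k2 * d) \*: (fun s : R => sin ((freq k2).2 * x.2 + (freq k2).1 * s))).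
      by rewrite derive_val /dot [_ * x.1 + _]addrC [LHS]mulrA; ring.
    apply/funext => t; rewrite /dot /= [_ * t + _]addrC.
    by rewrite mulrAC.
  have part2 (d : R) :
      partial2 (fun y : plane => a k2 * sin (dot (freq k2) y) * d) x =
      a k2 * (freq k2).2 * cos (dot (freq k2) x) * d.
    rewrite /partial2 derive1E.
    have := is_derive_sin_affine ((freq k2).1 * x.1) (freq k2).2 x.2 => dsin.
    rewrite (_ : (fun _ => _) =
        (a k2 * d) \*: (fun s : R => sin ((freq k2).1 * x.1 + (freq k2).2 * s))).
      by rewrite derive_val /dot [LHS]mulrA; ring.
    by apply/funext => t; rewrite /dot /= mulrAC.
  have modeE k : mode (flow a) k =
      fun x => scale (a k * sin (dot (freq k) x)) (perp (freq k)).
    by apply/funext => y; exact: mode_flow.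
  rewrite /advect !modeE /= !part1 !part2 /c /dot /scale /perp /=.
  by congr pair; ring.
rewrite leray_fourier_sin_cos; congr flow; apply/funext => m.
rewrite /c /coupling.
by have := sq_norm_Z2plus m; set n := sq_norm _ => n1; field; lra.
Qed.

Lemma tseries_addE (f g : tseries R) m :
  (f + g) m = ((f m).1 + (g m).1, (f m).2 + (g m).2).
Proof. by []. Qed.

Lemma laplacian_flow a : laplacian (flow a) = flow (fun m => - sq_norm (val m) * a m).
Proof.
apply/funext => m; rewrite /laplacian /laplacian0 /pair_series !tseries_addE.
rewrite /flow /comp1 /comp2 /d1 /d2 /sq_norm /scale /dot /=.
by congr ((_, _), (_, _)); ring.
Qed.

Lemma divergence_flow a : divergence (flow a) = 0.
Proof.
apply/funext => m; rewrite /divergence tseries_addE.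
rewrite /flow /comp1 /comp2 /d1 /d2 /scale /=.
by congr pair; ring.
Qed.

(* The l^2 norm is bounded by the l^1 norm; this spares any use of Minkowski. *)
Lemma esum_sqr_le (T : choiceType) (f g : T -> R) :
  (forall t, 0 <= f t) -> (forall t, 0 <= g t) -> (forall t, f t <= g t ^+ 2) ->
  (sqrte (\esum_(t in [set: T]) (f t)%:E) <= \esum_(t in [set: T]) (g t)%:E)%E.
Proof.
move=> f0 g0 fg; set G := (X in (_ <= X)%E).
have G0 : (0 <= G)%E by apply: esum_ge0 => t _; rewrite lee_fin.
rewrite -[leRHS]gee0_abs// -sqrte_sqr lee_sqrt ?sqre_ge0//.
apply: ge_ereal_sup => /= _ [X [finX _] <-].
have XG : (\sum_(t \in X) (g t)%:E <= G)%E.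
  by apply: ereal_sup_ubound; exists X.
rewrite fsbig_finite//=; rewrite fsbig_finite//= in XG.
apply: (@le_trans _ _ ((\sum_(t <- fset_set X) (g t)%:E) ^+ 2)%E); last first.
  by rewrite !expe2; apply: lee_pmul => //; apply: sume_ge0 => t _; rewrite lee_fin.
rewrite !sumEFin -EFin_expe lee_fin.
elim: (enum_fset (fset_set X)) => [|t s IH]; first by rewrite !big_nil expr0n.
rewrite !big_cons sqrrD -addrA lerD// (le_trans IH)// lerDr mulrn_wge0// mulr_ge0//.
exact: sumr_ge0.
Qed.

Lemma normE_flow b k : normE (flow b k).1 ^+ 2 + normE (flow b k).2 ^+ 2 =
  b k ^+ 2 * sq_norm (val k).
Proof.
rewrite !sqr_sqrtr ?addr_ge0//= -?expr2 ?sqr_ge0//.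
by rewrite /sq_norm /dot/=; ring.
Qed.

Lemma sobolev_norm_flow (s : R) b g : (forall k, 0 <= g k) ->
  (forall k, (1 + sq_norm (val k)) `^ s * (b k ^+ 2 * sq_norm (val k) / 2) <= g k ^+ 2) ->
  (sobolev_norm s (flow b) <= \esum_(k in [set: Z2plus]) (g k)%:E)%E.
Proof.
move=> g0 bg; apply: esum_sqr_le => // k.
  by rewrite mulr_ge0 ?powR_ge0// divr_ge0// addr_ge0 ?sqr_ge0.
by rewrite sq_normE normE_flow.
Qed.

(** With n = |m|^2, the mode contributes b^2 n^3 / 2 before weighting: n^2 from the factor [sq_norm]
    and n from m^perp. The weight (1 + n)^-4 absorbs this. *)
Lemma sobolev_norm4_flow b :
  (sobolev_norm (- 4%:R)%R (flow (fun m => b m * sq_norm (val m))%R)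
     <= \esum_(m in [set: Z2plus]) (`|b m|%R)%:E)%E.
Proof.
apply: sobolev_norm_flow => // m; rewrite real_normK ?num_real//.
have := sq_norm_Z2plus m; set n := sq_norm _ => n1.
rewrite powRN powR_mulrn; last lra.
rewrite mulrC ler_pdivrMr ?exprn_gt0//; last lra.
have : 0 <= b m ^+ 2 by exact: sqr_ge0.
have -> : (b m * n) ^+ 2 * n / 2 = b m ^+ 2 * (n ^+ 3 / 2) by field.
move=> b0; apply: ler_wpM2l => //.
have n3 : 0 <= n ^+ 3 by rewrite exprn_ge0//; lra.
have n4 : n ^+ 3 <= n ^+ 4 by rewrite [leRHS]exprS ler_peMl.
apply: (@le_trans _ _ (n ^+ 4)); first lra.
by rewrite lerXn2r// ?nnegrE; lra.
Qed.

Lemma sobolev_norm1_flow b :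
  (sobolev_norm (- 1)%R (flow b) <= \esum_(m in [set: Z2plus]) (`|b m|%R)%:E)%E.
Proof.
apply: sobolev_norm_flow => // m; rewrite real_normK ?num_real//.
have := sq_norm_Z2plus m; set n := sq_norm _ => n1.
rewrite powRN powRr1; last lra.
rewrite mulrC ler_pdivrMr; last lra.
by have := sqr_ge0 (b m); nra.
Qed.
End Sine_flows.

(** * From the balance of the coefficients to the steady equation *)

Section Esum.
Context {R : realType}.

Lemma exchange_esum (T1 T2 : choiceType) (I : set T1) (J : set T2) (f : T1 -> T2 -> \bar R) :
  (forall i j, (0 <= f i j)%E) ->
  \esum_(i in I) \esum_(j in J) f i j = \esum_(j in J) \esum_(i in I) f i j.
Proof.
move=> f0; rewrite !esum_esum//.
rewrite (@reindex_esum _ _ _ (I `*`` fun=> J) (J `*`` fun=> I) (fun k => (k.2, k.1)))//.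
split; first by move=> [i j] [].
  by move=> [i j] [i' j'] _ _ [-> ->].
by move=> [j i] [/= Jj Ii]; exists (i, j).
Qed.

Lemma esumZl_le (T : choiceType) (c : R) (f : T -> R) : 0 <= c -> (forall t, 0 <= f t) ->
  (c%:E * (\esum_(t in [set: T]) (f t)%:E)%R <= \esum_(t in [set: T]) (c * f t)%:E)%E.
Proof.
move=> c0 f0; case: (ltgtP c 0) c0 => // [cp _|->]; last first.
  by rewrite mul0e esum_ge0// => t _; rewrite mul0r.
rewrite -lee_pdivlMl//; apply: ge_ereal_sup => /= _ [X [finX _] <-].
rewrite lee_pdivlMl//; apply: esum_ge; exists X => //.
by rewrite !fsbig_finite//= !sumEFin -EFinM mulr_sumr.
Qed.

Lemma fset_sum_le_esum (T : choiceType) (f : T -> R) (A : {fset T}) (I : set T) :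
  {subset A <= I} -> ((\sum_(t <- A) f t)%:E <= \esum_(t in I) (f t)%:E)%E.
Proof.
move=> AI; apply: esum_ge; exists [set` A].
  by split=> // t /= /AI; rewrite inE.
by rewrite fsbig_finite//= set_fsetK sumEFin.
Qed.

(** [A0] is a finite set whose sum is within [e] of the total; what lies outside any larger finite
    set is then less than [e]. *)
Lemma esum_tail (T : choiceType) (F : T -> \bar R) (e : R) : (forall t, (0 <= F t)%E) ->
  (\esum_(t in [set: T]) F t < +oo)%E -> 0 < e ->
  exists A0 : {fset T}, forall A : {fset T}, (A0 `<=` A)%fset ->
    (\esum_(t in ~` [set` A]) F t < e%:E)%E.
Proof.
move=> F0 Foo e0; set S := (X in (X < _)%E) in Foo.
have S0 : (0 <= S)%E by apply: esum_ge0.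
have Sfin : S \is a fin_num by rewrite ge0_fin_numE.
have [_ /= [X [finX _] <-] SX] := ub_ereal_sup_adherent e0 Sfin.
exists (fset_set X) => A XA.
have AS : (\sum_(t <- fset_set X) F t + \esum_(t in ~` [set` A]) F t <= S)%E.
  rewrite /S [leRHS](esumID [set` A])// !setTI leeD2r//.
  apply: esum_ge; exists X; last by rewrite fsbig_finite.
  by split=> // t Xt; apply: (fsubsetP XA); rewrite in_fset_set// inE.
have {}SX : (S < \sum_(t <- fset_set X) F t + e%:E)%E.
  by rewrite -lteBlDr//; move: SX; rewrite fsbig_finite.
rewrite -(@lteD2lE _ (\sum_(t <- fset_set X) F t)%E); first exact: le_lt_trans AS SX.
rewrite ge0_fin_numE; last exact: sume_ge0.
apply: le_lt_trans Foo; apply: le_trans AS; rewrite leeDl//.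
exact: esum_ge0.
Qed.
End Esum.

(** * Admissibility and the steady equation for a summable sine flow *)

Section Reduction.
Context {R : realType}.
Notation plane := (measurableTypeR R * measurableTypeR R)%type.
Variable a : Z2plus -> R.

(** What the ordered pair [p] contributes to the equation at [m], after division by |m|^2. *)
Definition exchange (p : Z2plus * Z2plus) (m : Z2plus) : R :=
  a p.1 * a p.2 * coupling (val p.1) (val p.2) (val m).

Hypothesis a_summable : (\esum_(k in [set: Z2plus]) (`|a k|%R)%:E < +oo)%E.
Hypothesis exchange_summable :
  (\esum_(k1 in [set: Z2plus]) \esum_(k2 in [set: Z2plus]) \esum_(m in [set: Z2plus])
     (`|exchange (k1, k2) m|%R)%:E < +oo)%E.
(** Only finitely many pairs reach a given [m], so that the equation there is a finite identity,
    free of any limit. *)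
Hypothesis balance : forall m, exists B : {fset Z2plus * Z2plus},
  (forall p, p \notin B -> exchange p m = 0) /\ a m + \sum_(p <- B) exchange p m = 0.

Lemma periodic_distribution_flow : periodic_distribution (flow a).
Proof.
pose S := \esum_(k in [set: Z2plus]) (`|a k|%R)%:E.
have S0 : (0 <= S)%E by apply: esum_ge0 => k _; rewrite lee_fin.
have Sfin : S \is a fin_num by rewrite ge0_fin_numE.
exists (fine S), 1%N => k.
have ak : `|a k| <= fine S.
  rewrite -lee_fin fineK//.
  have -> : `|a k| = \sum_(t <- [fset k]%fset) `|a t| by rewrite big_seq_fset1.
  by apply: fset_sum_le_esum => t _; rewrite inE.
rewrite /flow /normE /dot /= !mulr0 addr0 sqrtr0 add0r expr1.
rewrite (_ : _ + _ = a k ^+ 2 * dot (freq k) (freq k)); last by rewrite /dot/=; ring.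
by rewrite sqrtrM ?sqr_ge0// sqrtr_sqr ler_wpM2r// sqrtr_ge0.
Qed.

Lemma admissible_flow : admissible (flow a).
Proof.
split; first exact: periodic_distribution_flow.
  exact: divergence_flow.
(* Admissibility asks for nonnegative amplitudes on cosines: the amplitude is |a k|, and the phase -
   pi / 2 or pi / 2 carries the sign of [a k]. *)
pose sg k : R := if 0 <= a k then 1 else -1.
pose theta k : R := if 0 <= a k then - (pi / 2) else pi / 2.
have cosE k (y : R) : cos (y + theta k) = sg k * sin y.
  rewrite /theta /sg; case: ifP => _; first by rewrite cosBpihalf mul1r.
  by rewrite cosDpihalf mulN1r.
have sinE k (y : R) : sin (y + theta k) = - sg k * cos y.
  rewrite /theta /sg; case: ifP => _; first by rewrite sinBpihalf mulN1r.
  by rewrite sinDpihalf opprK mul1r.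
have sg1 k : `|sg k| = 1 by rewrite /sg; case: ifP; rewrite ?normrN normr1.
have asg k : `|a k| * sg k = a k.
  rewrite /sg; case: ifPn => [a0|]; first by rewrite ger0_norm// mulr1.
  by rewrite -ltNge => a0; rewrite ltr0_norm// mulrN1 opprK.
exists (fun k => `|a k|), theta; split => //.
  by move=> k x; rewrite mode_flow cosE mulrA asg.
exists 4%N; apply: le_lt_trans exchange_summable.
apply: le_esum => k1 _; apply: le_esum => k2 _.
pose c : R := - (sg k1 * sg k2 * dot (perp (freq k1)) (freq k2)).
rewrite (_ : leray _ = flow (fun m =>
    (- (sg k1 * sg k2) * coupling (val k1) (val k2) (val m)) * sq_norm (val m))); last first.
  transitivity (leray (fourier_vec (fun x : plane =>
      scale (c * (sin (dot (freq k1) x) * cos (dot (freq k2) x))) (perp (freq k2))))).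
    congr (leray (fourier_vec _)); apply/funext => x; rewrite cosE sinE /c.
    by congr scale; ring.
  rewrite leray_fourier_sin_cos; congr flow; apply/funext => m; rewrite /c /coupling.
  by have := @sq_norm_Z2plus R m; set n := sq_norm _ => n1; field; lra.
apply: (@le_trans _ _ ((`|a k1| * `|a k2|)%:E * \esum_(m in [set: Z2plus])
    (`|(- (sg k1 * sg k2) * coupling (val k1) (val k2) (val m))|%R)%:E)%E).
  by rewrite lee_wpmul2l ?lee_fin ?mulr_ge0// sobolev_norm4_flow.
apply: le_trans (esumZl_le _ _) _; rewrite ?mulr_ge0//.
apply: le_esum => m _; rewrite lee_fin /exchange /=.
by rewrite !normrM normrN normrM !sg1 !mul1r.
Qed.

Lemma sobolev_flow : sobolev (- 1) (flow a).
Proof. exact: le_lt_trans (sobolev_norm1_flow a) a_summable. Qed.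

Lemma sum_flow (A : {fset Z2plus * Z2plus}) (b : Z2plus * Z2plus -> Z2plus -> R) :
  \sum_(p <- A) flow (b p) = flow (fun m => \sum_(p <- A) b p m).
Proof.
elim: (enum_fset A) => [|p s IH].
  by rewrite big_nil; apply/funext => m; rewrite /flow big_nil /scale/= !mul0r.
rewrite big_cons IH; apply/funext => m.
rewrite /flow big_cons /scale [LHS]/GRing.add /=.
by rewrite [LHS]/GRing.add /=; congr ((_, _), (_, _)); rewrite ?addr0// mulrDl.
Qed.

Lemma flowB (b c : Z2plus -> R) : flow b - flow c = flow (fun m => b m - c m).
Proof.
apply/funext => m; transitivity (((0 - 0 : R, 0 - 0 : R),
  (b m * (perp (freq m)).1 - c m * (perp (freq m)).1,
   b m * (perp (freq m)).2 - c m * (perp (freq m)).2))); first by [].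
by rewrite /flow /scale; congr ((_, _), (_, _)); ring.
Qed.

(** By [balance] the residual is the sum over [B] minus the sum over [A]. Pairs of [A] outside [B]
    contribute 0, which leaves the pairs of [B] outside [A]. *)
Lemma balance_tail (A : {fset Z2plus * Z2plus}) m :
  ((`|- a m - \sum_(p <- A) exchange p m|%R)%:E <=
   \esum_(p in ~` [set` A]) (`|exchange p m|%R)%:E)%E.
Proof.
have [B [B0 aB]] := balance m.
have -> : - a m - \sum_(p <- A) exchange p m = \sum_(p <- (B `\` A)%fset) exchange p m.
  have -> : - a m = \sum_(p <- B) exchange p m.
    by apply/esym/eqP; rewrite -addr_eq0 addrC aB.
  rewrite (big_fsetID _ (mem A))/= addrC.
  rewrite [X in _ - X](big_fsetID _ (mem B))/=.
  rewrite [X in _ - (_ + X)]big1_fset ?addr0; last first.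
    by move=> p; rewrite !inE => /andP[_ pB] _; exact: B0.
  rewrite (_ : [fset x | x in A & x \in B]%fset = [fset x | x in B & x \in A]%fset); last first.
    by apply/fsetP => p; rewrite !inE /= andbC.
  rewrite addrK; congr (\sum_(p <- enum_fset _) _).
  by apply/fsetP => p; rewrite !inE /= andbC.
apply: (@le_trans _ _ (\sum_(p <- (B `\` A)%fset) `|exchange p m|)%:E).
  by rewrite lee_fin ler_norm_sum.
apply: fset_sum_le_esum => p; rewrite !inE => /andP[pA _].
by rewrite /= (negbTE pA).
Qed.

Lemma steady_navier_stokes_flow : steady_navier_stokes (flow a).
Proof.
split; last exact: divergence_flow.
(* The sum is taken to be the Laplacian itself: the equation becomes trivial, and the content is
   that the double series converges to it. *)
exists (laplacian (flow a)); last by rewrite subrr.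
exists 4%N; split.
  apply: le_lt_trans exchange_summable.
  apply: le_esum => k1 _; apply: le_esum => k2 _.
  by rewrite interaction_flow; exact: sobolev_norm4_flow.
move=> e e0.
have F0 (p : Z2plus * Z2plus) :
    (0 <= \esum_(m in [set: Z2plus]) (`|exchange p m|%R)%:E)%E.
  by apply: esum_ge0 => m _; rewrite lee_fin.
have Foo : (\esum_(p in [set: Z2plus * Z2plus]) \esum_(m in [set: Z2plus])
    (`|exchange p m|%R)%:E < +oo)%E.
  move: exchange_summable; rewrite esum_esum//.
  rewrite (_ : _ `*`` _ = setT); last by apply/seteqP; split.
  by under eq_esum do rewrite -surjective_pairing.
have [A0 A0e] := esum_tail F0 Foo e0.
exists A0 => A /A0e; apply: le_lt_trans.
under eq_bigr do rewrite interaction_flow.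
rewrite sum_flow laplacian_flow.
rewrite flowB (_ : (fun m => _) = fun m =>
    (- a m - \sum_(p <- A) exchange p m) * sq_norm (val m)); last first.
  by apply/funext => m; rewrite mulrBl mulr_suml !mulNr mulrC.
apply: le_trans (sobolev_norm4_flow _) _.
(* Exchanging the sums writes the tail over pairs as a sum over [m], so that [balance_tail] applies
   frequency by frequency. *)
rewrite -exchange_esum//.
by apply: le_esum => m _; exact: balance_tail.
Qed.
End Reduction.

(** * Bounded stream functions *)

Section Bmo.
Context {R : realType}.
Notation plane := (measurableTypeR R * measurableTypeR R)%type.
Notation area := (@lebesgue_measure R \x @lebesgue_measure R)%E.

Lemma le_mean (a b r : R) (f : plane -> R) (M : R) : 0 < r ->
  measurable_fun [set: plane] f -> (forall x, `|f x| <= M) -> mean a b r f <= M.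
Proof.
move=> r0 mf fM; rewrite /mean ler_pdivrMl ?exprn_gt0// mulrC.
have -> : M * r ^+ 2 = (\int[area]_(x in square a b r) M)%R.
  rewrite Rintegral_cst; last exact: measurable_square.
  by congr (_ * _); rewrite -[RHS]/(fine (area _)) area_square.
apply: le_Rintegral; first exact: measurable_square.
- exact: bounded_integrable_square fM.
- by apply: (bounded_integrable_square (M := `|M|)).
- by move=> x _; exact: le_trans (ler_norm _) (fM x).
Qed.

(** A function bounded by [M] has mean oscillation at most 2 M: [M] for the function and [M] for its
    mean. *)
Lemma bmo_bounded (f : plane -> R) (M : R) : torus_periodic f ->
  measurable_fun [set: plane] f -> (forall x, `|f x| <= M) -> bmo f.
Proof.
move=> pf mf fM; split => //.
  by move=> a b r r0; exact: bounded_integrable_square fM.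
exists (M + M) => a b r r0.
apply: le_mean => //.
  by apply: measurableT_comp => //; apply: measurable_realfun.measurable_funD.
move=> x; rewrite normr_id (le_trans (ler_normB _ _))// lerD//.
rewrite ler_norml le_mean// andbT -lerNl.
have -> : - mean a b r f = mean a b r (\- f).
  rewrite /mean -mulrN; congr (_ * _); rewrite -mulN1r -RintegralZl.
  - by apply: eq_Rintegral => y _; rewrite mulN1r.
  - exact: measurable_square.
  - exact: bounded_integrable_square fM.
apply: le_mean => //; first exact: measurableT_comp.
by move=> y; rewrite normrN.
Qed.

(** Serves orthogonality: a sum of two frequencies of [Z2plus] is never 0, so that only their
    difference can produce a non-zero integral. *)
Lemma half_latticeD (p q : int * int) : half_lattice p -> half_lattice q -> half_lattice (p + q).
Proof. by case: p q => [x y] [x' y']; rewrite /half_lattice /=; lia. Qed.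

Variable a : Z2plus -> R.
Hypothesis a_summable : (\esum_(k in [set: Z2plus]) (`|a k|%R)%:E < +oo)%E.
(** An enumeration makes the stream function the limit of a sequence, to which dominated convergence
    applies. *)
Variable e : nat -> Z2plus.
Hypothesis e_bij : bijective e.

Let partial (n : nat) (x : plane) : R :=
  \sum_(0 <= t < n) a (e t) * cos (dot (freq (e t)) x).
Let psi (x : plane) : R := limn (partial^~ x).
Let M : R := fine (\esum_(k in [set: Z2plus]) (`|a k|%R)%:E).

Lemma partial_sum_le n : \sum_(0 <= t < n) `|a (e t)| <= M.
Proof.
rewrite -lee_fin fineK; last first.
  by rewrite ge0_fin_numE// esum_ge0// => k _; rewrite lee_fin.
rewrite (@reindex_esum _ _ _ [set: nat] _ e); last first.
  split => //; first by apply: in2W; exact: bij_inj e_bij.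
  by move=> k _; have [g _ gK] := e_bij; exists (g k).
apply: esum_ge; exists `I_n; first by split => //; exact: finite_II.
by rewrite -fsbig_ord big_mkord sumEFin.
Qed.

Lemma term_le t x : `|a (e t) * cos (dot (freq (e t)) x)| <= `|a (e t)|.
Proof. by rewrite normrM ler_piMr// ler_norml cos_geN1 cos_le1. Qed.

Lemma partial_le n x : `|partial n x| <= M.
Proof.
apply: le_trans (partial_sum_le n); apply: le_trans (ler_norm_sum _ _ _) _.
by apply: ler_sum => t _; exact: term_le.
Qed.

Lemma partial_cvg x : partial n x @[n --> \oo] --> psi x.
Proof.
suff : cvgn (series (fun t => a (e t) * cos (dot (freq (e t)) x))) by [].
apply: normed_cvg; apply: nondecreasing_is_cvgn.
  by apply: nondecreasing_series => t *; exact: normr_ge0.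
exists M => _ [n _ <-]; apply: le_trans (partial_sum_le n).
by apply: ler_sum => t _; exact: term_le.
Qed.

Lemma measurable_partial n : measurable_fun [set: plane] (partial n).
Proof.
apply: measurable_sum => t; apply: measurable_realfun.measurable_funM => //.
apply: eq_measurable_fun (measurable_cos_mode 0 (val (e t))).
by move=> x _; rewrite add0r.
Qed.

Lemma measurable_psi : measurable_fun [set: plane] psi.
Proof.
apply: measurable_fun_cvg measurable_partial _ => x _; exact: partial_cvg.
Qed.

Lemma psi_le x : `|psi x| <= M.
Proof.
have cx := cvgP _ (@partial_cvg x).
rewrite ler_norml; apply/andP; split.
  by apply: limr_ge => //; apply: nearW => n; have := partial_le n x; rewrite ler_norml => /andP[].
by apply: limr_le => //; apply: nearW => n; have := partial_le n x; rewrite ler_norml => /andP[].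
Qed.

Lemma psi_periodic : torus_periodic psi.
Proof.
move=> x; split; congr (limn _); apply/funext => n; apply: eq_bigr => t _; congr (_ * _).
  rewrite -(cosD2pi_int (dot (freq (e t)) x) (val (e t)).1); congr cos.
  by rewrite /dot /freq/=; ring.
rewrite -(cosD2pi_int (dot (freq (e t)) x) (val (e t)).2); congr cos.
by rewrite /dot /freq/=; ring.
Qed.

Lemma Rintegral_partial (phi : R) (k : Z2plus) n :
  (\int[area]_(x in torus_cell) (partial n x * cos (phi + dot (freq k) x)))%R =
  \sum_(0 <= t < n) a (e t) * (e t == k)%:R * (2 * pi ^+ 2 * cos phi).
Proof.
pose s := flatten [seq [:: (a (e t) / 2, phi, val k + val (e t));
                           (a (e t) / 2, phi, val k - val (e t))] | t <- iota 0 n].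
rewrite (Rintegral_cos_modes (s := s)).
  rewrite /s big_flatten big_map /index_iota subn0; apply: eq_bigr => t _.
  rewrite !big_cons big_nil /= addr0.
  rewrite (negbTE (half_lattice_neq0 (half_latticeD (valP k) (valP (e t))))).
  rewrite mulr0 add0r subr_eq0 -val_eqE [in RHS]eq_sym.
  by case: eqP => _ /=; rewrite ?(mulr0, mul0r)//; field.
move=> x; rewrite /s big_flatten big_map /partial /index_iota subn0 mulr_suml.
apply: eq_bigr => t _; rewrite !big_cons big_nil /= addr0 !dotDl !dotNl.
rewrite -[dot (freq k) x]/(dot (zvec (val k)) x) -[dot (freq (e t)) x]/(dot (zvec (val (e t))) x).
by rewrite !(sinD, cosD, sinN, cosN); field.
Qed.

(** Orthogonality for the partial sums, then dominated convergence with the constant majorant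
    [M]. *)
Lemma Rintegral_psi (phi : R) (k : Z2plus) :
  (\int[area]_(x in torus_cell) (psi x * cos (phi + dot (freq k) x)))%R =
  2 * pi ^+ 2 * cos phi * a k.
Proof.
have pi2 : (0 : R) < 2 * pi by rewrite mulr_gt0 ?pi_gt0.
have mcell : measurable (torus_cell : set plane) by exact: measurable_square.
have M0 : 0 <= M by apply: le_trans (psi_le 0).
have mc := measurable_cos_mode phi (val k).
have mP n : measurable_fun [set: plane] (fun x => partial n x * cos (phi + dot (freq k) x)).
  by apply: measurable_realfun.measurable_funM => //; exact: measurable_partial.
have bP n x : `|partial n x * cos (phi + dot (freq k) x)| <= M.
  by rewrite normrM -[leRHS]mulr1 ler_pM// ?partial_le// ler_norml cos_geN1 cos_le1.
have iM : area.-integrable (torus_cell : set plane) (cst M%:E).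
  by apply: (bounded_integrable_square (f := cst M) (M := `|M|)).
have := @dominated_convergence _ _ _ area _ mcell
  (fun n x => (partial n x * cos (phi + dot (freq k) x))%:E)
  (fun x => (psi x * cos (phi + dot (freq k) x))%:E) (cst M%:E).
case.
- by move=> n; apply/measurable_EFinP; exact: measurable_funTS.
- apply/measurable_EFinP; apply: measurable_funTS.
  by apply: measurable_realfun.measurable_funM => //; exact: measurable_psi.
- apply: aeW => x _; apply: cvg_EFin; first exact: nearW.
  by apply: cvgMl; exact: partial_cvg.
- exact: iM.
- by apply: aeW => x n _; rewrite lee_fin.
move=> _ _ /= cvgI.
have [g eK gK] := e_bij.
have lim2 : ((fun n => \int[area]_(x in torus_cell)
      (partial n x * cos (phi + dot (freq k) x))%:E) @ \oo
    --> (2 * pi ^+ 2 * cos phi * a k)%:E)%E.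
  (* Only the term of index [g k] survives, so the integrals are constant once [n] exceeds it. *)
  apply: cvg_near_cst; exists (g k).+1 => // n /= gn.
  rewrite -[LHS]fineK; last first.
    by apply: integrable_fin_num => //; exact: bounded_integrable_square (bP n).
  rewrite -/(Rintegral _ _ _) Rintegral_partial; congr (_%:E).
  rewrite (bigD1_seq (g k)) ?mem_index_iota ?iota_uniq//= gK eqxx big1 ?addr0.
    by rewrite mulr1 mulrC.
  move=> t tg; rewrite (_ : (e t == k) = false) ?mulr0 ?mul0r//.
  by apply: contraNF tg => /eqP <-; rewrite eK.
by rewrite /Rintegral (cvg_unique _ cvgI lim2).
Qed.

Lemma fourier_psi : fourier psi = fun k => (a k, 0).
Proof.
have pi0 : pi != 0 :> R by rewrite gt_eqF// pi_gt0.
apply/funext => k; rewrite /fourier.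
have IC : (\int[area]_(x in torus_cell) (psi x * cos (dot (freq k) x)))%R = 2 * pi ^+ 2 * a k.
  transitivity (2 * pi ^+ 2 * cos 0 * a k); last by rewrite cos0 mulr1.
  by rewrite -Rintegral_psi; apply: eq_Rintegral => x _; rewrite add0r.
have IS : (\int[area]_(x in torus_cell) (psi x * sin (dot (freq k) x)))%R = 0.
  transitivity (2 * pi ^+ 2 * cos (- (pi / 2)) * a k); last first.
    by rewrite cosN cos_pihalf mulr0 mul0r.
  rewrite -Rintegral_psi; apply: eq_Rintegral => x _.
  by rewrite addrC cosBpihalf.
rewrite IC IS mulr0; congr pair; move: pi0; generalize (@pi R) => P P0.
by field.
Qed.

Lemma exists_bmo_potential : exists f : plane -> R, bmo f /\ fourier f = fun k => (a k, 0).
Proof.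
exists psi; split; last exact: fourier_psi.
exact: bmo_bounded psi_periodic measurable_psi psi_le.
Qed.

End Bmo.

Section Bmo_inv.
Context {R : realType}.

(** sin(k.x) k^perp is the rotated gradient of - cos(k.x): the components are [d2] and [d1] of
    bounded functions [f] and [g] with cosine coefficients a and - a. The remaining potential [z]
    has zero coefficients. *)
Lemma bmo_inv_vec_flow (a : Z2plus -> R) (e : nat -> Z2plus) : bijective e ->
  (\esum_(k in [set: Z2plus]) (`|a k|%R)%:E < +oo)%E -> bmo_inv_vec (flow a).
Proof.
move=> e_bij a_summable.
have zero_summable : (\esum_(k in [set: Z2plus]) (`|(fun=> 0 : R) k|%R)%:E < +oo)%E.
  by rewrite esum1 ?ltry// => k _; rewrite normr0.
have opp_summable : (\esum_(k in [set: Z2plus]) (`|- a k|%R)%:E < +oo)%E.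
  by under eq_esum do rewrite normrN.
have [f [bf ff]] := exists_bmo_potential a_summable e_bij.
have [g [bg fg]] := exists_bmo_potential opp_summable e_bij.
have [z [bz fz]] := exists_bmo_potential zero_summable e_bij.
split.
  exists z, f; split => //; rewrite ff fz; apply/funext => k.
  rewrite tseries_addE /flow /comp1 /d1 /d2 /scale /perp /=.
  by congr pair; ring.
exists g, z; split => //; rewrite fg fz; apply/funext => k.
rewrite tseries_addE /flow /comp2 /d1 /d2 /scale /perp /=.
by congr pair; ring.
Qed.

End Bmo_inv.

(** * Lacunary frequencies *)

Section Frequencies.
Variable e : nat -> Z2plus.
Hypothesis e_inj : injective e.
Let mu t : int * int := val (e t).
Implicit Types (p q : int * int) (s t i l : nat).

Definition norm1 (p : int * int) : nat := (`|p.1| + `|p.2|)%N.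

Local Arguments norm1 p%_ring_scope.

Lemma norm1D p q : (norm1 (p + q) <= norm1 p + norm1 q)%N.
Proof. by rewrite /norm1 /=; lia. Qed.

Lemma norm1N p : norm1 (- p) = norm1 p.
Proof. by rewrite /norm1 /=; lia. Qed.

Lemma norm1B p q : (norm1 p <= norm1 (p + q) + norm1 q)%N.
Proof. by rewrite /norm1 /=; lia. Qed.

(* 2 m + m^perp is neither parallel nor orthogonal to m: either would make the
   coupling of n and n + m at m vanish to leading order. *)
Definition spiral (p : int * int) : int * int := (2 * p.1 - p.2, 2 * p.2 + p.1).

Lemma norm1_spiral p : (norm1 p <= norm1 (spiral p) <= 3 * norm1 p)%N.
Proof. by rewrite /norm1 /spiral /=; lia. Qed.

(* The factor 100 makes the frequencies used before step t negligible against
   [carrier t]. *)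
Fixpoint growth t : nat := if t is s.+1 then 100 * growth s * norm1 (mu s) else 100.
Local Notation L := growth.

Lemma norm1_gt0 t : (0 < norm1 (mu t))%N.
Proof.
have := half_lattice_neq0 (valP (e t)); rewrite -/(mu t) /norm1.
by case: (mu t) => x y /=; rewrite -pair_eqE /= negb_and; lia.
Qed.

Lemma growth_ge100 t : (100 <= L t)%N.
Proof. by elim: t => //= t IH; have := norm1_gt0 t; nia. Qed.

Lemma growth_lt s t : (s < t)%N -> (100 * L s * norm1 (mu s) <= L t)%N.
Proof.
elim: t => // t IH; rewrite ltnS leq_eqVlt => /orP[/eqP -> //|/IH st] /=.
by have := norm1_gt0 t; have := growth_ge100 t; nia.
Qed.

Lemma growth_exp t : (100 ^ t.+1 <= L t)%N.
Proof. by elim: t => //= t IH; rewrite expnS; have := norm1_gt0 t; nia. Qed.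

(** The large frequency L (2 m + m^perp) of step [t], where m is [mu t]. *)
Definition carrier t : int * int :=
  ((L t)%:Z * (spiral (mu t)).1, (L t)%:Z * (spiral (mu t)).2).

Lemma norm1_carrier t : (L t * norm1 (mu t) <= norm1 (carrier t) <= 3 * (L t * norm1 (mu t)))%N.
Proof.
have -> : norm1 (carrier t) = (L t * norm1 (spiral (mu t)))%N.
  by rewrite /norm1 /carrier /= !abszM -mulnDr.
by have := norm1_spiral (mu t); nia.
Qed.

(* Step t creates the modes of index 2t and 2t+1. *)
Definition freqs i : int * int := carrier i./2 + (if odd i then mu i./2 else 0).

Lemma norm1_freqs i : ((L i./2 - 1) * norm1 (mu i./2) <= norm1 (freqs i)
   <= (3 * L i./2 + 1) * norm1 (mu i./2))%N.
Proof.
have := norm1_carrier i./2; have := growth_ge100 i./2.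
rewrite /freqs; set c := carrier _; case: odd.
  by have := norm1B c (mu i./2); have := norm1D c (mu i./2); nia.
by rewrite addr0; nia.
Qed.

(** Sizes lie between (L - 1) |mu| and (3 L + 1) |mu|, so the factor 100 in [growth] leaves a ratio
    of at least 20 between different steps. *)
Lemma freqs_lacunary i l : (i./2 < l./2)%N -> (20 * norm1 (freqs i) <= norm1 (freqs l))%N.
Proof.
move=> il; have := growth_lt il; have := norm1_freqs i; have := norm1_freqs l.
have := growth_ge100 i./2; have := growth_ge100 l./2.
have := norm1_gt0 i./2; have := norm1_gt0 l./2; nia.
Qed.

Lemma mu_lt_freqs t l : (t <= l./2)%N -> (20 * norm1 (mu t) <= norm1 (freqs l))%N.
Proof.
rewrite leq_eqVlt => /predU1P tl.
have := norm1_freqs l; have := growth_ge100 l./2; have := norm1_gt0 l./2.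
case: tl => [->|tl]; first nia.
by have := growth_lt tl; have := growth_ge100 t; have := norm1_gt0 t; nia.
Qed.

Lemma mu_inj : injective mu.
Proof. by move=> s t /val_inj /e_inj. Qed.

Lemma mu_opp s t : mu s = - mu t -> False.
Proof.
have := valP (e s); have := valP (e t); rewrite -/(mu s) -/(mu t).
case: (mu s) (mu t) => x y [x' y'] /= ht hs [ex ey]; move: ht hs; rewrite ex ey.
by rewrite /half_lattice /=; lia.
Qed.

Lemma half_cases i l : i./2 = l./2 -> i = l \/
  (odd i /\ i = i./2.*2.+1 /\ l = i./2.*2) \/ (odd l /\ l = i./2.*2.+1 /\ i = i./2.*2).
Proof.
move=> il; have := odd_double_half i; have := odd_double_half l; rewrite -il.
by case: (odd i); case: (odd l) => /=; lia.
Qed.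

Lemma freqs_even t : freqs t.*2 = carrier t.
Proof. by rewrite /freqs odd_double doubleK addr0. Qed.

Lemma freqs_odd t : freqs t.*2.+1 = carrier t + mu t.
Proof. by rewrite /freqs /= odd_double uphalf_double. Qed.

Lemma norm1_double p : norm1 (p + p) = (2 * norm1 p)%N.
Proof. by case: p => x y; rewrite /norm1 /=; lia. Qed.

(** The smaller frequency cannot cancel the larger one: |q| <= N + |p| with |p| <= |q| / 20. *)
Lemma lacunary_resonance p q N : (20 * norm1 p <= norm1 q)%N ->
  norm1 (p + q) = N \/ norm1 (p - q) = N -> (norm1 p <= 2 * N)%N /\ (norm1 q <= 2 * N)%N.
Proof.
move=> lac res; suff : (norm1 q <= N + norm1 p)%N by lia.
case: res => <-; first by rewrite addrC norm1B.
by rewrite -[norm1 (p - q)]norm1N opprB -[X in (_ <= _ + X)%N]norm1N norm1B.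
Qed.

(** c + (c + m) is close to 2 c, so both frequencies are controlled by their sum. *)
Lemma pair_resonance c m N : (100 * norm1 m <= norm1 c)%N ->
  norm1 (c + (c + m)) = N -> (norm1 c <= 2 * N)%N /\ (norm1 (c + m) <= 2 * N)%N.
Proof.
move=> big res; have := norm1B (c + c) m; rewrite -addrA res norm1_double.
by have := norm1D c m; lia.
Qed.

(** Modes of different steps are lacunary. Modes of one step [s] interact at their sum, of size
    about twice that of [carrier s], or at their difference, which is [mu s] up to sign and forces s
    = t. For the sum only its size matters, whence the form of the first alternative. *)
Lemma resonance i l t : i != l ->
  norm1 (freqs i + freqs l) = norm1 (mu t) \/
    (freqs i - freqs l = mu t \/ freqs i - freqs l = - mu t) ->
  [/\ (i./2 < t)%N, (l./2 < t)%N, (norm1 (freqs i) <= 2 * norm1 (mu t))%N &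
    (norm1 (freqs l) <= 2 * norm1 (mu t))%N] \/ (i./2 = t /\ l./2 = t).
Proof.
move=> il res.
(* Contrapositive of [mu_lt_freqs]: a size below 20 |mu t| means creation before step [t]. *)
have lt_of j : (norm1 (freqs j) < 20 * norm1 (mu t))%N -> (j./2 < t)%N.
  by apply: contraTltn; rewrite -leqNgt; exact: mu_lt_freqs.
have mu0 := norm1_gt0 t.
have res' : norm1 (freqs i + freqs l) = norm1 (mu t) \/ norm1 (freqs i - freqs l) = norm1 (mu t).
  by case: res => [|[->|->]]; rewrite ?norm1N; auto.
have [il2|il2|il2] := ltngtP i./2 l./2.
- left; have [bi bl] := lacunary_resonance (freqs_lacunary il2) res'.
  by split => //; apply: lt_of; lia.
- left; have [] := @lacunary_resonance (freqs l) (freqs i) (norm1 (mu t)) (freqs_lacunary il2).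
    by rewrite addrC -[norm1 (freqs l - freqs i)]norm1N opprB.
  by move=> bl bi; split => //; apply: lt_of; lia.
- pose s := i./2.
  have big : (100 * norm1 (mu s) <= norm1 (carrier s))%N.
    by have := norm1_carrier s; have := growth_ge100 s; have := norm1_gt0 s; nia.
  have pairE : (freqs i = carrier s + mu s /\ freqs l = carrier s) \/
              (freqs i = carrier s /\ freqs l = carrier s + mu s).
    case: (half_cases il2) => [/eqP|[[_ [ei el]]|[_ [el ei]]]].
    - by rewrite (negbTE il).
    - by left; rewrite {1}ei el freqs_even freqs_odd.
    - by right; rewrite {1}ei el freqs_even freqs_odd.
  case: res => [sum|dif].
    have [bi bl] : (norm1 (freqs i) <= 2 * norm1 (mu t))%N /\ (norm1 (freqs l) <= 2 * norm1 (mu t))%N.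
      case: pairE sum => [[-> ->]|[-> ->]]; last exact: pair_resonance.
      by rewrite addrC => /(pair_resonance big)[].
    by left; split => //; apply: lt_of; lia.
  right; suff -> : t = s by rewrite -il2.
  case: pairE dif => [[-> ->]|[-> ->]].
    by rewrite addrC addKr => -[/mu_inj//|/mu_opp].
  rewrite opprD addNKr => -[/esym|/oppr_inj/mu_inj//].
  by move/mu_opp.
Qed.
Lemma freqs_neq0 i : freqs i != 0.
Proof.
apply/eqP => k0; have := mu_lt_freqs (leqnn i./2); rewrite k0.
by have := norm1_gt0 i./2; rewrite /norm1 /=; lia.
Qed.

(** Stated up to sign, because each frequency is later replaced by its representative in [Z2plus].
    Between steps lacunarity decides; within a step, mu is non-zero and too small to equal plus or
    minus twice the carrier. *)
Lemma freqs_inj i l : freqs i = freqs l \/ freqs i = - freqs l -> i = l.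
Proof.
move=> kk; have nk : norm1 (freqs i) = norm1 (freqs l) by case: kk => ->; rewrite ?norm1N.
have [il2|il2|il2] := ltngtP i./2 l./2.
- have := freqs_lacunary il2; have := mu_lt_freqs (leqnn i./2); have := norm1_gt0 i./2; lia.
- have := freqs_lacunary il2; have := mu_lt_freqs (leqnn i./2); have := norm1_gt0 i./2; lia.
have big : (100 * norm1 (mu i./2) <= norm1 (carrier i./2))%N.
  by have := norm1_carrier i./2; have := growth_ge100 i./2; have := norm1_gt0 i./2; nia.
have m0 := norm1_gt0 i./2.
case: (half_cases il2) => [//|[[_ [ei el]]|[_ [el ei]]]]; exfalso.
  move: kk; rewrite {1 2}ei el freqs_even freqs_odd; move: m0 big; rewrite /norm1.
  case: (carrier _) (mu _) => cx cy [x y] /= m0 big.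
  by case=> [[h1 h2]|[h1 h2]]; lia.
move: kk; rewrite {1 2}ei el freqs_even freqs_odd; move: m0 big; rewrite /norm1.
case: (carrier _) (mu _) => cx cy [x y] /= m0 big.
by case=> [[h1 h2]|[h1 h2]]; lia.
Qed.
End Frequencies.

(** * Amplitudes *)

Section Coupling_bounds.
Context {R : realType}.
Implicit Types (p q m : int * int).

Lemma dot_le p q : `|dot (zvec p) (zvec q)| <= (norm1 p)%:R * (norm1 q)%:R :> R.
Proof.
rewrite /dot /zvec /norm1 /= !natrD !natr_absz !intr_norm.
apply: le_trans (ler_normD _ _) _; rewrite !normrM.
set a := `|p.1%:~R|; set b := `|p.2%:~R|; set c := `|q.1%:~R|; set d := `|q.2%:~R|.
have a0 : 0 <= a := normr_ge0 _; have b0 : 0 <= b := normr_ge0 _.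
have c0 : 0 <= c := normr_ge0 _; have d0 : 0 <= d := normr_ge0 _.
nra.
Qed.

Lemma dot_perp_le p q : `|dot (perp (zvec p)) (zvec q)| <= (norm1 p)%:R * (norm1 q)%:R :> R.
Proof.
rewrite [X in `|X|](_ : _ = dot (zvec (- p.2, p.1)) (zvec q)); last first.
  by rewrite /dot/= intrN.
apply: le_trans (dot_le _ _) _.
by rewrite (_ : norm1 (- p.2, p.1) = norm1 p)// /norm1/=; lia.
Qed.

Lemma norm1_le_sq_norm m : (norm1 m)%:R ^+ 2 <= 2 * sq_norm m :> R.
Proof.
rewrite /sq_norm /dot /zvec /norm1 /= natrD !natr_absz !intr_norm.
rewrite -!expr2 -(real_normK (num_real m.1%:~R)) -(real_normK (num_real m.2%:~R)).
set a := `|m.1%:~R|; set b := `|m.2%:~R|.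
have := sqr_ge0 (a - b); nra.
Qed.

(** With N = [norm1 m], the two dot products are at most 4 N^2 and 2 N^2, and N^2 <= 2 |m|^2: their
    product is at most 32 |m|^4, against the denominator 2 |m|^4. *)
Lemma coupling_le p q m : m != 0 -> (norm1 p <= 2 * norm1 m)%N -> (norm1 q <= 2 * norm1 m)%N ->
  `|coupling p q m| <= 16 * (`|odd_delta (p + q) m| + `|odd_delta (p - q) m|) :> R.
Proof.
move=> m0 pm qm.
pose N : R := (norm1 m)%:R.
have N1 : 1 <= N.
  rewrite ler1n; move: m0; case: m {pm qm N} => x y.
  by rewrite -pair_eqE /= /norm1 /= negb_and; lia.
have pN : (norm1 p)%:R <= 2 * N by rewrite -natrM ler_nat.
have qN : (norm1 q)%:R <= 2 * N by rewrite -natrM ler_nat.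
have p0 : 0 <= (norm1 p)%:R :> R by []. have q0 : 0 <= (norm1 q)%:R :> R by [].
have s1 : 1 <= sq_norm m :> R by exact: sq_norm_ge1.
have sN : N ^+ 2 <= 2 * sq_norm m := norm1_le_sq_norm m.
have A : `|dot (perp (zvec p)) (zvec q)| <= 4 * N ^+ 2 :> R.
  apply: le_trans (dot_perp_le _ _) _.
  have -> : 4 * N ^+ 2 = (2 * N) * (2 * N) by ring.
  exact: ler_pM.
have B : `|dot (zvec q) (zvec m)| <= 2 * N ^+ 2 :> R.
  apply: le_trans (dot_le _ _) _.
  have -> : 2 * N ^+ 2 = (2 * N) * N by ring.
  by apply: ler_pM => //; lra.
rewrite /coupling normrM normfV normrM normrM.
set D := `|odd_delta _ _ + _|; set D' := `|_| + `|_|.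
have DD : D <= D' by exact: ler_normD.
have D0 : 0 <= D by exact: normr_ge0.
have s2 : 0 < 2 * sq_norm m ^+ 2 :> R by rewrite mulr_gt0// exprn_gt0//; lra.
rewrite (ger0_norm (ltW s2)) ler_pdivrMr//.
have -> : 16 * D' * (2 * sq_norm m ^+ 2) = 32 * sq_norm m ^+ 2 * D' by ring.
apply: ler_pM; rewrite ?mulr_ge0//.
apply: (@le_trans _ _ ((4 * N ^+ 2) * (2 * N ^+ 2))); first exact: ler_pM.
have : (N ^+ 2) ^+ 2 <= (2 * sq_norm m) ^+ 2 by rewrite lerXn2r// nnegrE; nra.
by rewrite !expr2; nra.
Qed.

(** p^perp.p = 0: a single mode is a shear flow and does not act on itself. *)
Lemma coupling_diag p m : coupling p p m = 0 :> R.
Proof. by rewrite /coupling /dot /perp /=; ring. Qed.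

Lemma odd_delta_eq0 p m : p <> m -> p <> - m -> odd_delta p m = 0 :> R.
Proof.
by rewrite /odd_delta => /eqP/negbTE -> /eqP/negbTE ->; rewrite subrr.
Qed.

Lemma couplingNl p q m : coupling (- p) q m = coupling p q m :> R.
Proof.
rewrite /coupling (_ : - p + q = - (p - q)); last by rewrite opprB addrC.
rewrite -opprD !odd_deltaN /dot /perp /zvec /= !intrN; ring.
Qed.

Lemma couplingNr p q m : coupling p (- q) m = coupling p q m :> R.
Proof. by rewrite /coupling opprK /dot /zvec /= !intrN; ring. Qed.

End Coupling_bounds.

(** * Recursive choice of the amplitudes *)

Section Amplitudes.
Context {R : realType}.
Variable e : nat -> Z2plus.
Hypothesis e_inj : injective e.
Implicit Types (t i l : nat).
Let mu t : int * int := val (e t).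
Local Notation L := (growth e).
Local Notation freqs := (freqs e).

(* The left-hand side of the equation at mu t, restricted to the modes created
   before step t. *)
Definition source (b : nat -> R) t : R :=
  \sum_(0 <= i < t.*2) b i * `|odd_delta (freqs i) (mu t)| +
  \sum_(0 <= i < t.*2) \sum_(0 <= l < t.*2) b i * b l * coupling (freqs i) (freqs l) (mu t).

(* The two couplings of the new pair at mu t add up to L (4 L + 1) / 2. *)
Fixpoint amps t : nat -> R :=
  if t is s.+1 then fun i =>
    if (i < s.*2)%N then amps s i
    else if i == s.*2 then (L s)%:R^-1
    else - (2 * source (amps s) s) / (4 * (L s)%:R + 1)
  else fun=> 0.

(** Index [i] is filled at step [i./2] and never changed later, so [i./2.+1] steps determine it. *)
Definition amp i : R := amps i./2.+1 i.

Lemma ampsE t i : (i < t.*2)%N -> amps t i = amp i.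
Proof.
elim: t => // t IH; rewrite doubleS /amp => it.
have [it2|it2] := ltnP i t.*2; first by rewrite -[RHS]/(amp i) -IH//= it2.
rewrite (_ : i./2 = t)//; move: it it2 (odd_double_half i).
by case: odd => /=; lia.
Qed.

Lemma sourceE t : source (amps t) t = source amp t.
Proof.
congr (_ + _); first by apply: eq_big_nat => i /andP[_ it]; rewrite ampsE.
apply: eq_big_nat => i /andP[_ it]; apply: eq_big_nat => l /andP[_ lt].
by rewrite !ampsE.
Qed.

Lemma amp_even t : amp t.*2 = (L t)%:R^-1.
Proof. by rewrite /amp doubleK /= ltnn eqxx. Qed.

Lemma amp_odd t : amp t.*2.+1 = - (2 * source amp t) / (4 * (L t)%:R + 1).
Proof.
by rewrite /amp /= uphalf_double -sourceE ltnNge leqnSn /= gtn_eqF.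
Qed.

(** By [resonance], a non-zero coupling comes from two modes of size at most 2 |mu t|, where
    [coupling_le] applies; the bound on [i] excludes the pair of step [t]. *)
Lemma coupling_freqs i l t : (i < t.*2)%N -> 
  `|coupling (freqs i) (freqs l) (mu t)| <=
    16 * (`|odd_delta (freqs i + freqs l) (mu t)| + `|odd_delta (freqs i - freqs l) (mu t)|) :> R.
Proof.
move=> it.
have [->|il] := eqVneq i l; first by rewrite coupling_diag normr0 mulr_ge0// addr_ge0.
have mu0 : mu t != 0 by exact/half_lattice_neq0/valP.
have [res|nores] := pselect (norm1 (freqs i + freqs l) = norm1 (mu t) \/
    (freqs i - freqs l = mu t \/ freqs i - freqs l = - mu t)).
  have [[_ _ ni nl]|[it2]] := resonance e_inj il res; first exact: coupling_le.
  by move: it it2; lia.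
rewrite /coupling !odd_delta_eq0 ?addr0 ?mulr0 ?mul0r ?normr0 ?mulr0//.
all: by move=> h; apply: nores; auto; left; rewrite h ?norm1N.
Qed.

(** No step after [t] disturbs the equation at [mu t]: a non-zero coupling would fall, by
    [resonance], into one of the two excluded cases. *)
Lemma coupling_freqs0 i l t : ~~ ((i < t.*2)%N && (l < t.*2)%N) ->
  ~~ ((i./2 == t) && (l./2 == t)) -> coupling (freqs i) (freqs l) (mu t) = 0 :> R.
Proof.
move=> nlow nspec.
have [->|il] := eqVneq i l; first by rewrite coupling_diag.
have [res|nores] := pselect (norm1 (freqs i + freqs l) = norm1 (mu t) \/
    (freqs i - freqs l = mu t \/ freqs i - freqs l = - mu t)).
  have [[it lt _ _]|[it lt]] := resonance e_inj il res.
    by exfalso; move: nlow it lt; lia.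
  by exfalso; move: nspec; rewrite it lt eqxx.
rewrite /coupling !odd_delta_eq0 ?addr0 ?mulr0 ?mul0r//.
all: by move=> h; apply: nores; auto; left; rewrite h ?norm1N.
Qed.

Lemma odd_delta_le1 p m : `|odd_delta p m| <= 1 :> R.
Proof.
rewrite /odd_delta; case: eqP => _; case: eqP => _ /=;
 by rewrite ?subrr ?subr0 ?sub0r ?normrN ?normr0 ?normr1.
Qed.

Lemma amp_sum_source t : \sum_(0 <= i < t.*2) `|amp i| <= 1 -> `|source amp t| <= 33.
Proof.
set S := (X in X <= 1) => S1.
have S0 : 0 <= S by exact: sumr_ge0.
apply: le_trans (ler_normD _ _) _.
(* 1 bounds the linear part; 32 is 16 times the two terms of [coupling_freqs], for the quadratic
   part. *)
rewrite (_ : 33 = 1 + 32 :> R); last by ring.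
apply: lerD.
  apply: le_trans (ler_norm_sum _ _ _) _; apply: le_trans S1.
  apply: ler_sum => i _; rewrite normrM normr_id ler_piMr//; exact: odd_delta_le1.
apply: le_trans (ler_norm_sum _ _ _) _.
apply: (@le_trans _ _ (\sum_(0 <= i < t.*2) `|amp i| * 32)); last first.
  by rewrite -mulr_suml ler_piMl.
rewrite big_nat [leRHS]big_nat; apply: ler_sum => i /andP[_ it].
apply: le_trans (ler_norm_sum _ _ _) _.
apply: (@le_trans _ _ (\sum_(0 <= l < t.*2) `|amp l| * (`|amp i| * 32))); last first.
  by rewrite -mulr_suml ler_piMl// mulr_ge0.
apply: ler_sum => l _; rewrite 2!normrM mulrAC mulrC ler_wpM2l// ler_wpM2l//.
apply: le_trans (coupling_freqs _ it) _.
have := odd_delta_le1 (freqs i + freqs l) (mu t); have := odd_delta_le1 (freqs i - freqs l) (mu t).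
by lra.
Qed.

(** Bootstrap: a sum at most 1 bounds the source by 33, so step [t] adds at most 1 / L + 66 / (4 L +
    1) <= 18 / L, which is at most 2^-(t+1) because L >= 36 2^t. *)
Lemma amp_sum_le t : \sum_(0 <= i < t.*2) `|amp i| <= 1 - 2^-1 ^+ t.
Proof.
elim: t => [|t IH]; first by rewrite big_nil expr0 subrr.
have half0 : 0 <= 2^-1 ^+ t :> R by rewrite exprn_ge0.
have src : `|source amp t| <= 33 by apply: amp_sum_source; apply: le_trans IH _; lra.
rewrite doubleS !big_nat_recr//= amp_even amp_odd exprS.
have Lt : 36 * 2 ^+ t <= (L t)%:R :> R.
  rewrite -natrX -natrM ler_nat; apply: leq_trans (growth_exp e t).
  by rewrite expnS leq_mul//; case: (t) => // s; rewrite leq_exp2r.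
have two_t : 1 <= 2 ^+ t :> R by rewrite exprn_ege1//; lra.
set l : R := (L t)%:R in Lt *.
have l0 : 0 < l by lra.
rewrite normfV (ger0_norm (ltW l0)).
rewrite normrM normfV normrN normrM (ger0_norm (ler0n _ 2)) [X in _ / X]ger0_norm; last lra.
have : 2 * `|source amp t| / (4 * l + 1) <= 17 / l.
  rewrite ler_pdivrMr; last lra.
  by rewrite mulrAC ler_pdivlMr//; nra.
have : 18 / l <= 2^-1 * 2^-1 ^+ t.
  rewrite ler_pdivrMr// exprVn -invfM.
  by rewrite ler_pdivlMl ?mulr_gt0//; lra.
lra.
Qed.

Lemma amp_sum1 n : \sum_(0 <= i < n) `|amp i| <= 1.
Proof.
have half0 : 0 <= 2^-1 ^+ n :> R by rewrite exprn_ge0.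
apply: (@le_trans _ _ (1 - 2^-1 ^+ n)); last lra.
apply: le_trans (amp_sum_le n).
rewrite [leRHS](@big_cat_nat _ _ _ n)//=; last by rewrite -addnn leq_addr.
by rewrite lerDl sumr_ge0.
Qed.

Lemma odd_delta_mu t : odd_delta (mu t) (mu t) = 1 :> R.
Proof.
rewrite /odd_delta eqxx; case: eqP => [/mu_opp//|_].
by rewrite subr0.
Qed.

Lemma odd_delta_sum t : odd_delta (carrier e t + (carrier e t + mu t)) (mu t) = 0 :> R.
Proof.
have := norm1_carrier e t; have := growth_ge100 e t; have := norm1_gt0 e t.
rewrite -/(mu t) => m0 g100 /andP[+ _].
have {}g100 : (100 * norm1 (mu t) <= growth e t * norm1 (mu t))%N by nia.
move=> /(leq_trans g100) big.
apply: odd_delta_eq0 => h; have : norm1 (carrier e t + (carrier e t + mu t)) = norm1 (mu t).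
- by rewrite h.
- by move: big m0; rewrite /norm1 /=; lia.
- by rewrite h norm1N.
- by move: big m0; rewrite /norm1 /=; lia.
Qed.

Lemma zvec_carrier t : zvec (carrier e t) =
  ((L t)%:R * (2 * (mu t).1%:~R - (mu t).2%:~R),
   (L t)%:R * (2 * (mu t).2%:~R + (mu t).1%:~R)) :> R * R.
Proof. by rewrite /zvec /carrier /spiral /= !intrM intrB intrD !intrM. Qed.

Lemma zvecD p q : zvec (p + q) = (p.1%:~R + q.1%:~R, p.2%:~R + q.2%:~R) :> R * R.
Proof. by rewrite /zvec /= !intrD. Qed.

(** With c = L (2 m + m^perp), one has c^perp.m = - L |m|^2 and c.m = 2 L |m|^2, so that |m| cancels
    out. The same products give [coupling_pair_odd]. *)
Lemma coupling_pair_even t :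
  coupling (freqs t.*2) (freqs t.*2.+1) (mu t) = (L t)%:R * (2 * (L t)%:R + 1) / 2 :> R.
Proof.
rewrite freqs_even freqs_odd -/(mu t) /coupling odd_delta_sum add0r opprD addNKr.
rewrite odd_deltaN odd_delta_mu zvecD.
have [E1 E2] := zvec_carrier t.
have := @sq_norm_Z2plus R (e t); rewrite -/(mu t) /sq_norm /dot /perp /zvec /= ?E1 ?E2.
by set x := _.1%:~R; set y := _.2%:~R => s1; field; lra.
Qed.

Lemma coupling_pair_odd t :
  coupling (freqs t.*2.+1) (freqs t.*2) (mu t) = (L t)%:R ^+ 2 :> R.
Proof.
rewrite freqs_even freqs_odd -/(mu t) /coupling.
rewrite [carrier e t + mu t - _]addrC addKr [X in odd_delta X _ + _]addrC.
rewrite odd_delta_sum odd_delta_mu zvecD.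
have [E1 E2] := zvec_carrier t.
have := @sq_norm_Z2plus R (e t); rewrite -/(mu t) /sq_norm /dot /perp /zvec /= ?E1 ?E2.
by set x := _.1%:~R; set y := _.2%:~R => s1; field; lra.
Qed.

Lemma amp_pair_balance t :
  amp t.*2 * amp t.*2.+1 * coupling (freqs t.*2) (freqs t.*2.+1) (mu t) +
  amp t.*2.+1 * amp t.*2 * coupling (freqs t.*2.+1) (freqs t.*2) (mu t) = - source amp t.
Proof.
rewrite coupling_pair_even coupling_pair_odd amp_even amp_odd.
have : 100 <= (L t)%:R :> R by rewrite ler_nat growth_ge100.
by set l := (L t)%:R => l1; field; apply/andP; split; lra.
Qed.

(** The two interactions of the pair have the same sign and share [- source] in the proportions 2 L
    + 1 and 2 L over 4 L + 1: nothing is lost by taking absolute values. *)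
Lemma amp_pair_le t :
  `|amp t.*2 * amp t.*2.+1 * coupling (freqs t.*2) (freqs t.*2.+1) (mu t)| <= `|source amp t| /\
  `|amp t.*2.+1 * amp t.*2 * coupling (freqs t.*2.+1) (freqs t.*2) (mu t)| <= `|source amp t|.
Proof.
rewrite coupling_pair_even coupling_pair_odd amp_even amp_odd.
have : 100 <= (L t)%:R :> R by rewrite ler_nat growth_ge100.
set l := (L t)%:R => l1; set r := source amp t.
have frac (u : R) : 0 <= u <= 1 -> `|u * r| <= `|r|.
  by case/andP=> u0 u1; rewrite normrM ger0_norm// ler_piMl.
split.
  rewrite (_ : l^-1 * (- (2 * r) / (4 * l + 1)) * (l * (2 * l + 1) / 2) =
      (- ((2 * l + 1) / (4 * l + 1))) * r); last first.
    by field; apply/andP; split; lra.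
  rewrite mulNr normrN; apply: frac; apply/andP; split; first by rewrite divr_ge0//; lra.
  by rewrite ler_pdivrMr; lra.
rewrite (_ : - (2 * r) / (4 * l + 1) * l^-1 * l ^+ 2 = (- (2 * l / (4 * l + 1))) * r); last first.
  by field; apply/andP; split; lra.
rewrite mulNr normrN; apply: frac; apply/andP; split; first by rewrite divr_ge0//; lra.
by rewrite ler_pdivrMr; lra.
Qed.

(** The double sum reduces to the earlier modes and the two cross terms of the new pair, which
    cancel [source]. The absolute value of [odd_delta] identifies [freqs i] with its opposite,
    sin(k.x) k^perp being even in k. *)
Lemma amp_balance t :
  \sum_(0 <= i < t.*2) amp i * `|odd_delta (freqs i) (mu t)| +
  \sum_(0 <= i < t.*2.+2) \sum_(0 <= l < t.*2.+2)
    amp i * amp l * coupling (freqs i) (freqs l) (mu t) = 0.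
Proof.
pose c i l : R := amp i * amp l * coupling (freqs i) (freqs l) (mu t).
rewrite [X in _ + X](eq_bigr (fun i =>
  \sum_(0 <= l < t.*2) c i l + c i t.*2 + c i t.*2.+1)); last first.
  by move=> i _; rewrite !big_nat_recr.
rewrite !big_nat_recr//=.
have c0 i l : ~~ ((i < t.*2)%N && (l < t.*2)%N) -> ~~ ((i./2 == t) && (l./2 == t)) -> c i l = 0.
  by move=> h1 h2; rewrite /c coupling_freqs0 ?mulr0.
have half_low i : (i < t.*2)%N -> (i./2 == t) = false.
  by move=> it; apply/eqP => ti; move: it (odd_double_half i); rewrite ti; case: odd; lia.
have row_low : \sum_(0 <= i < t.*2) (\sum_(0 <= l < t.*2) c i l + c i t.*2 + c i t.*2.+1) =
    \sum_(0 <= i < t.*2) \sum_(0 <= l < t.*2) c i l.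
  apply: eq_big_nat => i /andP[_ it].
  have z1 : c i t.*2 = 0 by apply: c0; rewrite ?(half_low i)// ltnn andbF.
  have z2 : c i t.*2.+1 = 0 by apply: c0; rewrite ?(half_low i)// [X in _ && X]ltnNge leqnSn andbF.
  by rewrite z1 z2 !addr0.
have col0 i : (t.*2 <= i)%N -> \sum_(0 <= l < t.*2) c i l = 0.
  move=> ti; rewrite big_nat big1// => l /andP[_ lt].
  by apply: c0; [rewrite ltnNge ti|rewrite (half_low l)// andbF].
have diag i : c i i = 0 by rewrite /c coupling_diag mulr0.
rewrite row_low !col0// !diag !addr0 !add0r.
have := amp_pair_balance t; rewrite -/(c _ _) -/(c _ _) /source -/(mu t) => pair.
by move: pair; rewrite /c; lra.
Qed.
End Amplitudes.

(** * Summability of the interactions *)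

Section Esum_nat.
Context {R : realType}.

Lemma esum_nat_le (f : nat -> R) (K : R) : (forall i, 0 <= f i) ->
  (forall n, \sum_(0 <= i < n) f i <= K) -> (\esum_(i in [set: nat]) (f i)%:E <= K%:E)%E.
Proof.
move=> f0 fK; rewrite -nneseries_esumT//; apply: lime_le.
  by apply: is_cvg_nneseries => i _ _; rewrite lee_fin.
by apply: nearW => n; rewrite sumEFin lee_fin.
Qed.

Lemma esum_range (T : choiceType) (k : nat -> T) (f : T -> \bar R) : injective k ->
  (forall m, (forall i, k i <> m) -> f m = 0%E) ->
  \esum_(m in [set: T]) f m = \esum_(i in [set: nat]) f (k i).
Proof.
move=> k_inj f0; rewrite -(esum_image setT k f); last exact: in2W.
rewrite [RHS]esum_mkcond; apply: eq_esum => m _; case: ifPn => //.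
by move/negP => km; apply: f0 => i kim; apply: km; rewrite inE; exists i.
Qed.

Lemma sum_half_le (f : nat -> R) n : (forall i, 0 <= f i) ->
  \sum_(0 <= i < n) f i./2 <= 2 * \sum_(0 <= s < n) f s.
Proof.
move=> f0; apply: (@le_trans _ _ (\sum_(0 <= i < n.*2) f i./2)).
  rewrite [leRHS](@big_cat_nat _ _ _ n)//=; last by rewrite -addnn leq_addr.
  by rewrite lerDl sumr_ge0.
elim: n => [|n IH]; first by rewrite !big_nil mulr0.
rewrite doubleS !big_nat_recr//= uphalf_double doubleK.
by lra.
Qed.
End Esum_nat.

(** * Absolute convergence and the coefficients of the solution *)

Section Construction.
Context {R : realType}.
Variable e : nat -> Z2plus.
Hypothesis e_bij : bijective e.
Implicit Types (t i l : nat).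
Let e_inj : injective e := bij_inj e_bij.
Let mu t : int * int := val (e t).
Local Notation freqs := (freqs e).
Local Notation amp := (@amp R e).
Let src t := source e amp t.

(** The [mu t] are distinct and never opposite, so at most one term is non-zero. *)
Lemma sum_odd_delta_le1 p n : \sum_(0 <= t < n) `|odd_delta p (mu t)| <= 1 :> R.
Proof.
have [[t0 pt0]|none] := pselect (exists t0, p = mu t0 \/ p = - mu t0); last first.
  rewrite big1// => t _; rewrite odd_delta_eq0 ?normr0// => h; apply: none; exists t; auto.
have other t : t != t0 -> `|odd_delta p (mu t)| = 0 :> R.
  move/eqP => tt0; rewrite odd_delta_eq0 ?normr0// => h; apply: tt0.
    case: pt0; rewrite h; first by move/(mu_inj e_inj).
    by move/mu_opp.
  case: pt0; rewrite h; last by move/oppr_inj/(mu_inj e_inj).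
  by move/esym/mu_opp.
have [nt0|nt0] := ltnP t0 n.
  rewrite (bigD1_seq t0) ?mem_index_iota ?iota_uniq//= big1 ?addr0//.
  exact: odd_delta_le1.
rewrite big_nat big1// => t /andP[_ tn]; apply: other.
by rewrite neq_ltn (leq_trans tn).
Qed.

(* Bounds the interaction of any two modes that are not created together at
   step t. *)
Let q i l t : R := `|amp i| * `|amp l| *
  (16 * (`|odd_delta (freqs i + freqs l) (mu t)| + `|odd_delta (freqs i - freqs l) (mu t)|)).

Lemma q_ge0 i l t : 0 <= q i l t.
Proof. by rewrite /q !mulr_ge0// addr_ge0. Qed.

Lemma sum_q_t i l n : \sum_(0 <= t < n) q i l t <= `|amp i| * (`|amp l| * 32).
Proof.
rewrite /q -mulr_sumr -mulr_sumr big_split/= [leRHS]mulrA ler_wpM2l ?mulr_ge0//.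
have := sum_odd_delta_le1 (freqs i + freqs l) n; have := sum_odd_delta_le1 (freqs i - freqs l) n.
by lra.
Qed.

Lemma sum_amp_l i n : \sum_(0 <= l < n) `|amp i| * (`|amp l| * 32) <= `|amp i| * 32.
Proof. by rewrite -mulr_sumr -mulr_suml ler_wpM2l// ler_piMl// amp_sum1. Qed.

Lemma sum_amp_i n : \sum_(0 <= i < n) `|amp i| * 32 <= 32.
Proof. by rewrite -mulr_suml ler_piMl// amp_sum1. Qed.

(** Summed over [t] first, a mode counts at most once and a pair of modes at most twice with factor
    16, whence 1 + 32 for every [n]. *)
Lemma sum_source_le n : \sum_(0 <= t < n) `|src t| <= 33.
Proof.
have widen (f : nat -> R) t : (t < n)%N -> (forall i, 0 <= f i) ->
    \sum_(0 <= i < t.*2) f i <= \sum_(0 <= i < n.*2) f i.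
  move=> tn f0; rewrite [leRHS](@big_cat_nat _ _ _ t.*2)//=.
    by rewrite lerDl sumr_ge0.
  by rewrite leq_double ltnW.
(* Index ranges independent of [t] allow the sums to be exchanged. *)
apply: (@le_trans _ _ (\sum_(0 <= t < n)
   (\sum_(0 <= i < n.*2) `|amp i| * `|odd_delta (freqs i) (mu t)| +
    \sum_(0 <= i < n.*2) \sum_(0 <= l < n.*2) q i l t))).
  rewrite big_nat [leRHS]big_nat; apply: ler_sum => t /andP[_ tn].
  apply: le_trans (ler_normD _ _) _; apply: lerD.
    apply: le_trans (ler_norm_sum _ _ _) _; apply: le_trans (widen _ _ tn _); last first.
      by move=> i; rewrite mulr_ge0.
    by apply: ler_sum => i _; rewrite normrM normr_id.
  apply: le_trans (ler_norm_sum _ _ _) _.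
  apply: (@le_trans _ _ (\sum_(0 <= i < t.*2) \sum_(0 <= l < n.*2) q i l t)); last first.
    by apply: widen => // i; apply: sumr_ge0 => l _; exact: q_ge0.
  rewrite big_nat [leRHS]big_nat; apply: ler_sum => i /andP[_ it].
  apply: le_trans (ler_norm_sum _ _ _) _; apply: le_trans (widen _ _ tn _); last first.
    by move=> l; exact: q_ge0.
  apply: ler_sum => l _; rewrite 2!normrM ler_wpM2l ?mulr_ge0//.
  exact: coupling_freqs.
rewrite big_split/= (_ : 33 = 1 + 32); last by ring.
apply: lerD.
  rewrite exchange_big /=; apply: le_trans (@amp_sum1 R e e_inj n.*2).
  apply: ler_sum => i _; rewrite -mulr_sumr ler_piMr//.
  exact: sum_odd_delta_le1.
rewrite exchange_big /=; apply: le_trans (sum_amp_i n.*2).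
apply: ler_sum => i _; rewrite exchange_big /=; apply: le_trans (sum_amp_l i n.*2).
by apply: ler_sum => l _; exact: sum_q_t.
Qed.

(** The case left out of [q]: by [amp_pair_le], |src t| bounds either interaction of the pair of
    step [t]. *)
Let special i l t : R := if (i./2 == t) && (l./2 == t) then `|src t| else 0.

Lemma special_ge0 i l t : 0 <= special i l t.
Proof. by rewrite /special; case: ifP. Qed.

Lemma coupling_le_special i l t :
  `|amp i * amp l * coupling (freqs i) (freqs l) (mu t)| <= q i l t + special i l t.
Proof.
have [low|nlow] := boolP ((i < t.*2)%N && (l < t.*2)%N).
  rewrite ler_wpDr ?special_ge0// 2!normrM ler_wpM2l ?mulr_ge0//.
  by apply: coupling_freqs => //; case/andP: low.
rewrite /special; case: ifPn => [/andP[/eqP it /eqP lt]|nspec]; last first.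
  by rewrite coupling_freqs0// mulr0 normr0 addr0 q_ge0.
rewrite ler_wpDl ?q_ge0//.
have [->|il] := eqVneq i l; first by rewrite coupling_diag mulr0 normr0.
have [h1 h2] := @amp_pair_le R e t.
have [/eqP|[[_ [ei el]]|[_ [el ei]]]] := half_cases (etrans it (esym lt)).
- by rewrite (negbTE il).
- by rewrite ei el it.
- by rewrite ei el it.
Qed.

Lemma esum_coupling_lty :
  (\esum_(i in [set: nat]) \esum_(l in [set: nat]) \esum_(t in [set: nat])
    (`|amp i * amp l * coupling (freqs i) (freqs l) (mu t)|%R)%:E < +oo)%E.
Proof.
apply: (@le_lt_trans _ _ (\esum_(i in [set: nat]) \esum_(l in [set: nat])
    \esum_(t in [set: nat]) ((q i l t)%:E + (special i l t)%:E))%E).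
  apply: le_esum => i _; apply: le_esum => l _; apply: le_esum => t _.
  by rewrite -EFinD lee_fin coupling_le_special.
have q0 i l t : (0 <= (q i l t)%:E)%E by rewrite lee_fin q_ge0.
have s0 i l t : (0 <= (special i l t)%:E)%E by rewrite lee_fin special_ge0.
rewrite [X in (X < _)%E](_ : _ =
  \esum_(i in [set: nat]) \esum_(l in [set: nat]) \esum_(t in [set: nat]) (q i l t)%:E +
  \esum_(i in [set: nat]) \esum_(l in [set: nat]) \esum_(t in [set: nat])
    (special i l t)%:E)%E; last first.
  rewrite -esumD; do ?by move=> *; do !apply: esum_ge0 => *.
  apply: eq_esum => i _; rewrite -esumD; do ?by move=> *; do !apply: esum_ge0 => *.
  by apply: eq_esum => l _; rewrite -esumD.
(* 32 bounds the sum of [q]. 132 is 4 times the bound 33 on the sum of the sources, since each step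
   has two choices of [i] and two of [l]. *)
apply: (@le_lt_trans _ _ (32%:E + 132%:E)%E); last by rewrite -EFinD ltry.
apply: leeD.
  apply: (@le_trans _ _ (\esum_(i in [set: nat]) (`|amp i| * 32)%:E)).
    apply: le_esum => i _.
    apply: (@le_trans _ _ (\esum_(l in [set: nat]) (`|amp i| * (`|amp l| * 32))%:E)).
      apply: le_esum => l _; apply: esum_nat_le => n; first exact: q_ge0.
      exact: sum_q_t.
    by apply: esum_nat_le => n; [rewrite !mulr_ge0|exact: sum_amp_l].
  by apply: esum_nat_le => n; [rewrite mulr_ge0|exact: sum_amp_i].
apply: (@le_trans _ _ (\esum_(i in [set: nat]) (2 * `|src i./2|)%:E)).
  apply: le_esum => i _.
  apply: (@le_trans _ _ (\esum_(l in [set: nat]) (if l./2 == i./2 then `|src i./2| else 0)%:E)).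
    apply: le_esum => l _; apply: esum_nat_le => n; first exact: special_ge0.
    have [ni|ni] := ltnP i./2 n.
      rewrite (bigD1_seq i./2) ?mem_index_iota ?iota_uniq//= big1 ?addr0.
        by rewrite /special eqxx /=; case: eqP.
      by move=> t ti; rewrite /special eq_sym (negbTE ti).
    rewrite big_nat big1; first by case: ifP.
    move=> t /andP[_ tn]; rewrite /special (_ : (i./2 == t) = false)//.
    by rewrite gtn_eqF// (leq_trans tn).
  apply: esum_nat_le => n; first by case: ifP.
  apply: le_trans (@sum_half_le _ (fun s => if s == i./2 then `|src i./2| else 0) n _) _.
    by move=> s; case: ifP.
  rewrite ler_pM2l//.
  have [ni|ni] := ltnP i./2 n.
    rewrite (bigD1_seq i./2) ?mem_index_iota ?iota_uniq//= eqxx big1 ?addr0//.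
    by move=> s /negbTE ->.
  rewrite big_nat big1// => s /andP[_ sn]; rewrite (_ : (s == i./2) = false)//.
  by rewrite ltn_eqF// (leq_trans sn).
apply: esum_nat_le => n; first by rewrite mulr_ge0.
apply: le_trans (@sum_half_le _ (fun s => 2 * `|src s|) n _) _.
  by move=> s; rewrite mulr_ge0.
by rewrite -mulr_sumr; have := sum_source_le n; lra.
Qed.

Lemma half_lattice_or p : p != 0 -> half_lattice p || half_lattice (- p).
Proof. by case: p => x y; rewrite -pair_eqE /= /half_lattice /=; lia. Qed.

Lemma exists_coefficients : exists a : Z2plus -> R,
  [/\ exists k, a k != 0,
    (\esum_(k in [set: Z2plus]) (`|a k|%R)%:E < +oo)%E,
    (\esum_(k1 in [set: Z2plus]) \esum_(k2 in [set: Z2plus]) \esum_(m in [set: Z2plus])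
      (`|exchange a (k1, k2) m|%R)%:E < +oo)%E &
    forall m, exists B : {fset Z2plus * Z2plus},
      (forall p, p \notin B -> exchange a p m = 0) /\
      a m + \sum_(p <- B) exchange a p m = 0].
Proof.
(* [k i] represents [freqs i] up to sign; the sign is harmless because [coupling] is even in its
   first two arguments. *)
have /choice[k kE] : forall i, exists m : Z2plus, val m = freqs i \/ val m = - freqs i.
  move=> i; have /orP[h|h] := half_lattice_or (freqs_neq0 e i).
    by exists (exist (fun p => half_lattice p) _ h); left.
  by exists (exist (fun p => half_lattice p) _ h); right.
have k_inj : injective k.
  move=> i l kil; apply: (@freqs_inj e) => //.
  move: (kE i) (kE l); rewrite kil => -[->|->] [h|h]; rewrite -?h ?opprK; auto.
  by left; apply: oppr_inj.
have /choice[a aE] : forall m : Z2plus, exists x : R,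
    (forall i, k i = m -> x = amp i) /\ ((forall i, k i <> m) -> x = 0).
  move=> m; have [[i <-]|none] := pselect (exists i, k i = m).
    by exists (amp i); split => [l /k_inj -> //|/(_ i)].
  by exists 0; split => // i kim; exfalso; apply: none; exists i.
have ak i : a (k i) = amp i by apply: (aE _).1.
have a0 m : (forall i, k i <> m) -> a m = 0 by exact: (aE m).2.
have coupling_k i l m : coupling (val (k i)) (val (k l)) m = coupling (freqs i) (freqs l) m :> R.
  by case: (kE i) => ->; case: (kE l) => ->; rewrite ?couplingNl ?couplingNr.
have exk i l t : exchange a (k i, k l) (e t) =
    amp i * amp l * coupling (freqs i) (freqs l) (mu t).
  by rewrite /exchange /= !ak coupling_k.
exists a; split.
- exists (k 0%N); rewrite ak -[0%N]/(0%N.*2) amp_even invr_eq0 pnatr_eq0.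
  by have := growth_ge100 e 0; case: growth.
- apply: (@le_lt_trans _ _ 1%:E); last by rewrite ltry.
  rewrite (esum_range k_inj); last by move=> m /a0 ->; rewrite normr0.
  apply: esum_nat_le => n //; under eq_bigr do rewrite ak.
  exact: amp_sum1.
- rewrite (esum_range k_inj); last first.
    by move=> m /a0 am; do 2!(rewrite esum1// => ? _); rewrite /exchange /= am !mul0r normr0.
  apply: le_lt_trans esum_coupling_lty; apply: le_esum => i _.
  rewrite (esum_range k_inj); last first.
    by move=> m /a0 am; rewrite esum1// => ? _; rewrite /exchange /= am mulr0 mul0r normr0.
  apply: le_esum => l _; rewrite (esum_range e_inj); last first.
    by move=> m em; have [g _ gK] := e_bij; case: (em (g m)).
  by apply: le_esum => t _; rewrite exk.
move=> m; have [g _ gK] := e_bij; rewrite -(gK m); set t := g m.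
(* Indices below 2 t + 2 are those of the steps up to [t], the only ones that interact at [mu t]. *)
have [s sE] : exists s, s = [seq (k i, k l) |
    i <- index_iota 0 t.*2.+2, l <- index_iota 0 t.*2.+2] by eexists.
have s_uniq : uniq s.
  by rewrite sE; apply: allpairs_uniq; rewrite ?iota_uniq// =>
    -[i l] [i' l'] _ _ /= [/k_inj -> /k_inj ->].
exists [fset p in s]%fset; split.
  move=> [k1 k2]; rewrite inE => ps.
  have [[i ik]|/forallNP/a0 ak1] := pselect (exists i, k i = k1); last first.
    by rewrite /exchange /= ak1 !mul0r.
  have [[l lk]|/forallNP/a0 ak2] := pselect (exists l, k l = k2); last first.
    by rewrite /exchange /= ak2 mulr0 mul0r.
  rewrite -ik -lk exk.
  have nbox : ~~ ((i < t.*2.+2)%N && (l < t.*2.+2)%N).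
    apply: contra ps => /andP[it lt]; rewrite -ik -lk.
    by rewrite sE; apply/allpairsP; exists (i, l); rewrite /= !mem_index_iota.
  rewrite coupling_freqs0 ?mulr0//.
    by apply: contra nbox => /andP[it lt]; rewrite !ltnS !(leqW (ltnW _)).
  apply: contra nbox => /andP[/eqP it /eqP lt]; move: (odd_double_half i) (odd_double_half l).
  by rewrite it lt; case: odd; case: odd; lia.
(* For the linear terms: at most one mode has frequency [mu t] up to sign, and by [mu_lt_freqs] it
   was created before step [t], hence is in the range of the sum. *)
rewrite -[RHS](@amp_balance R e e_inj t); congr (_ + _).
  have kmu i : k i = e t <-> (freqs i = mu t \/ freqs i = - mu t).
    split=> [kit|kit]; first by case: (kE i); rewrite kit => h; [left|right; rewrite /mu h opprK].
    have [g' _ gK'] := e_bij; have := gK' (k i); set t' := g' _ => kt'.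
    have : mu t' = mu t \/ mu t' = - mu t.
      by rewrite /mu kt'; case: (kE i) => ->; case: kit => ->; rewrite ?opprK; auto.
    by case=> [/(mu_inj e_inj) <-//|/mu_opp].
  have [[i kit]|none] := pselect (exists i, k i = e t); last first.
    rewrite a0; last by move=> i kit; apply: none; exists i.
    rewrite big1// => i _; rewrite odd_delta_eq0 ?normr0 ?mulr0// => h;
      by apply: none; exists i; apply/kmu; auto.
  have it : (i < t.*2)%N.
    have nit : norm1 (freqs i) = norm1 (mu t) by case/kmu: kit => ->; rewrite ?norm1N.
    rewrite ltnNge; apply/negP => ti.
    have ti2 : (t <= i./2)%N by move: ti (odd_double_half i); case: odd; lia.
    have := @mu_lt_freqs e t i ti2; rewrite nit; have := norm1_gt0 e t; rewrite -/(mu t).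
    by lia.
  have -> : a (e t) = amp i by rewrite -kit ak.
  rewrite -/(mu t) (bigD1_seq i) ?mem_index_iota ?iota_uniq//= big1.
    have self : odd_delta (mu t) (mu t) = 1 :> R := odd_delta_mu e t.
    by rewrite addr0; case/kmu: kit => ->; rewrite ?odd_deltaN self ?normrN normr1 mulr1.
  move=> l /eqP li; rewrite odd_delta_eq0 ?normr0 ?mulr0// => h; apply/li/k_inj;
    by rewrite kit; apply/kmu; auto.
rewrite (_ : \sum_(p <- _) _ = \sum_(p <- s) exchange a p (e t)).
  rewrite sE big_allpairs_dep; apply: eq_bigr => i _; apply: eq_bigr => l _.
  exact: exk.
apply: perm_big; apply: uniq_perm => // p.
by rewrite inE.
Qed.
End Construction.

(** [Z2plus] is countable, and infinite because it contains the positive half-axis. *)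
Lemma exists_enumeration : exists e : nat -> Z2plus, bijective e.
Proof.
have axis_half (n : nat) : half_lattice (n.+1%:Z, 0) by [].
pose axis (n : nat) : Z2plus := exist (fun p => half_lattice p) (n.+1%:Z, 0) (axis_half n).
have axis_inj : injective axis by move=> n l /(congr1 val)[].
have : ([set: Z2plus] #= [set: nat])%card.
  rewrite card_eq_le; apply/andP; split; first exact: countableP.
  rewrite -(card_le_eql (inj_card_eq (in2W axis_inj))).
  exact: subset_card_le.
case/card_set_bijP => f; rewrite setTT_bijective => -[e fK eK].
by exists e, f.
Qed.

Theorem theorem1 (R : realType) :
  exists u : tseries (R * R),
    [/\ u <> 0,
        admissible u,
        steady_navier_stokes u,
        sobolev (-1) u &
        bmo_inv_vec u].
Proof.
have [e e_bij] := exists_enumeration.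
have [a [[k ak] a_summable exchange_summable balance]] := @exists_coefficients R e e_bij.
exists (flow a); split.
(* Pairing the mode [k] of a zero flow with k^perp would give a_k |k|^2 = 0, although neither factor
   is 0. *)
- move/(congr1 (fun u => (u k).2)) => /= flow0.
  have := sq_norm_Z2plus (R := R) k.
  have : a k * sq_norm (val k) = 0.
    have := congr1 (fun v : R * R => dot v (perp (freq k))) flow0.
    rewrite /flow /scale /dot /perp /sq_norm /zvec /= !mul0r addr0 => <-.
    by rewrite /dot /=; ring.
  by move/eqP; rewrite mulf_eq0 (negbTE ak) /= => /eqP ->; rewrite ler10.
- exact: admissible_flow.
- exact: steady_navier_stokes_flow.
- exact: sobolev_flow.
- exact: bmo_inv_vec_flow e_bij a_summable.
Qed.
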